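(* Let $\sigma,\mu$ be positive measures on $\mathbb R$ with $\int_{\mathbb R}\frac{d\sigma(u)}{u^2+1}<\infty$ and $\int_{\mathbb R}\frac{d\mu(u)}{u^2+1}<\infty$, such that the associated real Hilbert spaces $\mathcal H(\sigma)$ and $\mathcal H(\mu)$ are separable and infinite-dimensional, with orthonormal bases $(g_n)_{n\ge0}$ and $(h_n)_{n\ge0}$ respectively. Put $P_1=P_\sigma$, $P_2=P_\mu$, $Z_n=Q^\sigma_{g_n}$, $W_n=Q^\mu_{h_n}$, and for $p=\lambda_1e_++\lambda_2e_-\in\mathbb H$ let $$B_p=\sum_{n=0}^\infty\left[\left(\int_0^{\lambda_1}\zeta_n(u)\,du\right)Z_n\,e_++\left(\int_0^{\lambda_2}\zeta_n(u)\,du\right)W_n\,e_-\right]$$ (each component converging in $L^2(P_1)$, respectively $L^2(P_2)$). Then for every $p=\lambda_1e_++\lambda_2e_-\in\mathbb H$ the sum $$N_p=\sum_{n=0}^\infty\left[\zeta_n(\lambda_1)Z_n\,e_++\zeta_n(\lambda_2)W_n\,e_-\right]$$ belongs to $\mathcal K'$, where $\mathcal K'=\mathcal K'_1e_+\oplus\mathcal K'_2e_-$ is the space of $\mathbb H$-valued stochastic distributions, and $N_p$ is the derivative of $B_p$ in the topology of $\mathcal K'$, in the sense that $$\lim_{\substack{h\to0\\ h\in\mathbb H,\ h^{-1}\text{ exists}}}\frac{B_{p+h}-B_p}{h}=N_p .$$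
   Context: Hyperbolic numbers: $\mathbb H=\{a+bk: a,b\in\mathbb R\}$ with $k\notin\mathbb R$ commuting with the reals and $k^2=1$. Put $e_\pm=\frac{1\pm k}{2}$; then $e_\pm^2=e_\pm$, $e_+e_-=0$, $e_++e_-=1$, and each $p\in\mathbb H$ is uniquely $p=\lambda_1e_++\lambda_2e_-$ with $\lambda_1,\lambda_2\in\mathbb R$ (operations are componentwise); $h=h_1e_++h_2e_-$ is invertible iff $h_1h_2\neq0$. The norm on $\mathbb H$ is $\|a+bk\|=\sqrt{a^2+b^2}$. White noise measures: $\mathcal S_{\mathbb R}$ is the space of real-valued Schwartz functions on $\mathbb R$, $\mathcal S'_{\mathbb R}$ its dual, $\mathcal C$ the cylinder $\sigma$-algebra of $\mathcal S'_{\mathbb R}$, and $\widehat s(u)=\int_{\mathbb R}e^{-iut}s(t)\,dt$. For a positive measure $\sigma$ with $\int\frac{d\sigma(u)}{u^2+1}<\infty$, $P_\sigma$ is the unique probability measure on $(\mathcal S'_{\mathbb R},\mathcal C)$ (given by the Bochner–Minlos theorem) with $e^{-\frac12\int|\widehat s(u)|^2d\sigma(u)}=\int_{\mathcal S'_{\mathbb R}}e^{i\langle w,s\rangle}dP_\sigma(w)$ for $s\in\mathcal S_{\mathbb R}$. $\mathcal H(\sigma)$ is the real Hilbert space completion of $\mathcal S_{\mathbb R}$ (modulo null vectors) for the inner product $\mathrm{Re}\int_{\mathbb R}\overline{\widehat{s_1}}\,\widehat{s_2}\,d\sigma$. The map $s\mapsto Q^\sigma_s$, $Q^\sigma_s(w)=\langle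 w,s\rangle$, is isometric into $L^2(\mathcal S'_{\mathbb R},\mathcal C,P_\sigma)$, and $Q^\sigma$ also denotes its extension to an isometry on $\mathcal H(\sigma)$. Normalized Hermite functions: $\zeta_n(x)=\frac{(-1)^n}{\pi^{1/4}2^{n/2}(n!)^{1/2}}e^{x^2/2}\left(\frac{d}{dx}\right)^ne^{-x^2}$, $n=0,1,2,\dots$ Kondratiev space of stochastic distributions: let $\ell$ be the set of sequences $\alpha=(\alpha_0,\alpha_1,\dots)$ of non-negative integers with finitely many nonzero entries, $(2\mathbb N)^\alpha=\prod_{n\ge0}(2(n+1))^{\alpha_n}$, and let $\mathsf h_0,\mathsf h_1,\dots$ be the probabilists' Hermite polynomials. For $P_1=P_\sigma$ put $H_\alpha=\prod_{n\ge0}\mathsf h_{\alpha_n}(Z_n)$; these form an orthogonal basis of $L^2(\mathcal S'_{\mathbb R},\mathcal C,P_1)$ with $\|H_\alpha\|^2=\alpha!$; in particular $Z_n=H_{\varepsilon_n}$, where $\varepsilon_n$ has a $1$ at index $n$ and $0$ elsewhere. For $k\in\mathbb N$ let $\mathcal H_k$ be the Hilbert space of formal series $f=\sum_{\alpha\in\ell}c_\alpha H_\alpha$, $c_\alpha\in\mathbb R$, with $\|f\|_{-k}^2=\sum_\alpha|c_\alpha|^2(2\mathbb N)^{-k\alpha}<\infty$. Then $\mathcal K'_1=\bigcup_{k\in\mathbb N}\mathcal H_k$ with the inductive limit topology (which coincides with the strong topology of $\mathcal K'_1$ as the dual of the Kondratiev space of test functions $\bigcap_k\mathcal G_k$, where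 $\mathcal G_k$ consists of the series with $\sum_\alpha(\alpha!)^2|c_\alpha|^2(2\mathbb N)^{k\alpha}<\infty$); $L^2(P_1)$ is contained in $\mathcal K'_1$. The space $\mathcal K'_2$ is built in the same way from $P_2=P_\mu$ and $(W_n)$. $\mathcal K'=\mathcal K_1'e_+\oplus\mathcal K_2'e_-$ carries the product topology. *)

(* Defs.v *)
From HB Require Import structures.
From mathcomp Require Import all_boot all_order all_algebra finmap complex ring lra.
From mathcomp Require Import all_classical all_reals all_analysis.

Set Implicit Arguments.
Unset Strict Implicit.
Unset Printing Implicit Defensive.

Import Order.TTheory GRing.Theory Num.Def Num.Theory.
Import numFieldNormedType.Exports.

Local Open Scope classical_set_scope.
Local Open Scope complex_scope.
Local Open Scope ring_scope.

(* [Hyp a b] is a + b k, with k^2 = 1. *)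
Record hyp (R : realType) := Hyp { hre : R; him : R }.

Section Hyperbolic.
Variable R : realType.
Local Notation H := (hyp R).

Definition pair_of_hyp (p : H) : R * R := (hre p, him p).
Definition hyp_of_pair (p : R * R) : H := Hyp p.1 p.2.
Lemma pair_of_hypK : cancel pair_of_hyp hyp_of_pair. Proof. by case. Qed.
HB.instance Definition _ := Choice.copy H (can_type pair_of_hypK).

Definition hadd (p q : H) : H := Hyp (hre p + hre q) (him p + him q).
Definition hopp (p : H) : H := Hyp (- hre p) (- him p).
Definition hmul (p q : H) : H :=
  Hyp (hre p * hre q + him p * him q) (hre p * him q + him p * hre q).

Lemma haddA : associative hadd.
Proof. by move=> p q r; congr Hyp; rewrite /= addrA. Qed.
Lemma haddC : commutative hadd.
Proof. by move=> p q; congr Hyp; rewrite /= addrC. Qed.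
Lemma hadd0 : left_id (Hyp 0 0) hadd.
Proof. by case=> a b; congr Hyp; rewrite /= add0r. Qed.
Lemma haddN : left_inverse (Hyp 0 0) hopp hadd.
Proof. by move=> p; congr Hyp; rewrite /= addNr. Qed.
HB.instance Definition _ := GRing.isZmodule.Build H haddA haddC hadd0 haddN.

Lemma hmulA : associative hmul.
Proof. by move=> p q r; congr Hyp => /=; ring. Qed.
Lemma hmulC : commutative hmul.
Proof. by move=> p q; congr Hyp => /=; ring. Qed.
Lemma hmul1 : left_id (Hyp 1 0) hmul.
Proof. by case=> a b; congr Hyp => /=; ring. Qed.
Lemma hmulDl : left_distributive hmul hadd.
Proof. by move=> p q r; congr Hyp => /=; ring. Qed.
Lemma hone_neq0 : Hyp 1 0 != 0 :> H.
Proof. by apply/eqP => -[] /eqP; rewrite oner_eq0. Qed.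
HB.instance Definition _ :=
  GRing.Zmodule_isComNzRing.Build H hmulA hmulC hmul1 hmulDl hone_neq0.

Definition lam1 (p : H) : R := hre p + him p.
Definition lam2 (p : H) : R := hre p - him p.

Definition eplus : H := Hyp 2^-1 2^-1.
Definition eminus : H := Hyp 2^-1 (- 2^-1).
Definition hreal (a : R) : H := Hyp a 0.

Lemma hyp_idempotentE (p : H) :
  p = hreal (lam1 p) * eplus + hreal (lam2 p) * eminus.
Proof. by case: p => a b; congr Hyp; rewrite /lam1 /lam2 /=; field. Qed.

Lemma lamP (a b : R) : let p := hreal a * eplus + hreal b * eminus in
  lam1 p = a /\ lam2 p = b.
Proof. by rewrite /lam1 /lam2 /=; split; field. Qed.

Definition hunit : {pred H} := fun p => lam1 p * lam2 p != 0.
Definition hinv (p : H) : H :=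
  if p \in hunit then Hyp (hre p / (lam1 p * lam2 p)) (- him p / (lam1 p * lam2 p))
  else p.

Lemma hmulV : {in hunit, left_inverse 1 hinv *%R}.
Proof.
move=> p pu; rewrite /hinv pu; move: pu; rewrite unfold_in /hunit /lam1 /lam2 => pu.
suff : hmul (Hyp (hre p / ((hre p + him p) * (hre p - him p)))
  (- him p / ((hre p + him p) * (hre p - him p)))) p = Hyp 1 0 by [].
by move: pu; rewrite mulf_eq0 negb_or => /andP[pu1 pu2];
  congr Hyp => /=; field; apply/andP.
Qed.
Lemma hunitP (p q : H) : q * p = 1 -> hunit p.
Proof.
case: p q => [a b] [c d] [e1 e2]; apply/eqP; rewrite /lam1 /lam2 /= => ab0.
have : (c + d) * (c - d) * ((a + b) * (a - b)) = 1.
  have -> : (c + d) * (c - d) * ((a + b) * (a - b)) =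
    (c * a + d * b) ^+ 2 - (c * b + d * a) ^+ 2 by ring.
  by rewrite e1 e2; ring.
by rewrite ab0 mulr0 => /esym/eqP; rewrite oner_eq0.
Qed.
Lemma hinv_out : {in [predC hunit], hinv =1 id}.
Proof. by move=> p; rewrite inE /= /hinv => /negbTE ->. Qed.
HB.instance Definition _ :=
  GRing.ComNzRing_hasMulInverse.Build H hmulV hunitP hinv_out.

Definition hnorm (p : H) : R := Num.sqrt (hre p ^+ 2 + him p ^+ 2).

Definition hyp_units_to0 : set_system H :=
  within [set h | h \is a GRing.unit]
    (filter_from [set e : R | 0 < e] (fun e => [set h | hnorm h < e])).

End Hyperbolic.
Arguments hyp_units_to0 R : clear implicits.

Section TranslationTopology.
Variables (V : zmodType) (B : set_system V).

Definition translate_nbhs (x : V) : set_system V :=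
  [set A | exists2 U, B U & forall v, U v -> A (x + v)].

Hypothesis Bn0 : exists U, B U.
Hypothesis BI : forall U W, B U -> B W -> exists2 X, B X & X `<=` U `&` W.
Hypothesis B0 : forall U, B U -> U 0.
Hypothesis Bhalf : forall U, B U ->
  exists2 W, B W & forall x y, W x -> W y -> U (x + y).

Lemma translate_nbhs_filter x : ProperFilter (translate_nbhs x).
Proof.
apply: Build_ProperFilter_ex.
  by move=> A [U BU UA]; exists (x + 0); apply: UA; exact: B0.
split.
- by have [U BU] := Bn0; exists U.
- move=> A C [U BU UA] [W BW WC]; have [X BX XUW] := BI BU BW.
  by exists X => // v /XUW[Uv Wv]; split; [exact: UA|exact: WC].
- by move=> A C AC [U BU UA]; exists U => // v /UA/AC.
Qed.

Lemma translate_nbhs_singleton x A : translate_nbhs x A -> A x.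
Proof. by case=> U BU UA; rewrite -[x]addr0; apply: UA; exact: B0. Qed.

Lemma translate_nbhs_nbhs x A :
  translate_nbhs x A -> translate_nbhs x (translate_nbhs^~ A).
Proof.
case=> U BU UA; have [W BW WU] := Bhalf BU; exists W => // v Wv.
by exists W => // w Ww; rewrite -addrA; apply: UA; exact: WU.
Qed.

End TranslationTopology.

Section Schwartz.
Variable R : realType.
Implicit Types f g : R -> R.

Definition schwartz f : Prop :=
  (forall n x, derivable (derive1n n f) x 1) /\
  (forall m n, exists C : R, forall x, `|x ^+ m * derive1n n f x| <= C).

Lemma schwartz0 : schwartz 0.
Proof.
have d0 n : derive1n n (0 : R -> R) = 0.
  elim: n => [//|n IHn]; rewrite derive1nS IHn; apply/funext => x.
  exact: derive1_cst.
split=> [n x|m n]; first by rewrite d0; exact: derivable_cst.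
by exists 0 => x; rewrite d0 mulr0 normr0.
Qed.

Lemma schwartz_derive1n_lin (a : R) f g n : schwartz f -> schwartz g ->
  derive1n n (a *: f + g) = a *: derive1n n f + derive1n n g.
Proof.
move=> [df _] [dg _]; elim: n => [//|n IHn].
rewrite !derive1nS IHn; apply/funext => x; rewrite derive1E.
rewrite deriveD ?deriveZ//=; first by rewrite -!derive1E.
exact: derivableZ.
Qed.

Lemma schwartz_lin (a : R) f g : schwartz f -> schwartz g ->
  schwartz (a *: f + g).
Proof.
move=> sf sg; have E n := schwartz_derive1n_lin a n sf sg.
move: sf sg => [df bf] [dg bg]; split=> [n x|m n].
  by rewrite E; apply: derivableD => //; exact: derivableZ.
have [C hC] := bf m n; have [D hD] := bg m n.
exists (`|a| * C + D) => x; rewrite E.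
have -> : x ^+ m * (a *: derive1n n f + derive1n n g) x =
    a * (x ^+ m * derive1n n f x) + x ^+ m * derive1n n g x.
  rewrite -[(a *: _ + _) x]/(a * derive1n n f x + derive1n n g x); ring.
apply: (le_trans (ler_normD _ _)); apply: lerD => //.
by rewrite normrM ler_wpM2l.
Qed.

Definition schwartz_pred : {pred R -> R} := fun f => `[< schwartz f >].

Lemma schwartz_submod_closed : submod_closed schwartz_pred.
Proof.
split=> [|a f g]; rewrite !unfold_in; first exact/asboolP/schwartz0.
by move=> /asboolP sf /asboolP sg; exact/asboolP/schwartz_lin.
Qed.
HB.instance Definition _ :=
  GRing.isSubmodClosed.Build R (R -> R) schwartz_pred schwartz_submod_closed.

Record schwartz_space :=
  SchwartzFun { schwartz_fun :> R -> R; _ : schwartz_fun \in schwartz_pred }.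
HB.instance Definition _ := [isSub for schwartz_fun].
HB.instance Definition _ := [Choice of schwartz_space by <:].
HB.instance Definition _ := [SubChoice_isSubLmodule of schwartz_space by <:].

Definition schwartz_ball (N : nat) (e : R) : set schwartz_space :=
  [set s | forall m n x, (m <= N)%N -> (n <= N)%N ->
     `|x ^+ m * derive1n n s x| <= e].

Definition schwartz_base : set_system schwartz_space :=
  [set U | exists N e, 0 < e /\ U = schwartz_ball N e].

Definition schwartz_nbhs := translate_nbhs schwartz_base.
HB.instance Definition _ := hasNbhs.Build schwartz_space schwartz_nbhs.

Let sbase_n0 : exists U, schwartz_base U.
Proof. by exists (schwartz_ball 0 1), 0%N, 1. Qed.

Let sbaseI U W : schwartz_base U -> schwartz_base W ->
  exists2 X, schwartz_base X & X `<=` U `&` W.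
Proof.
move=> [N [e [e0 ->]]] [M [d [d0 ->]]].
exists (schwartz_ball (maxn N M) (Num.min e d)).
  by exists (maxn N M), (Num.min e d); split=> //; rewrite lt_min e0.
move=> s hs; split=> m n x mN nN; have := hs m n x; rewrite !leq_max mN nN ?orbT.
  by move=> /(_ isT isT); rewrite le_min => /andP[].
by move=> /(_ isT isT); rewrite le_min => /andP[].
Qed.

Let sbase0 U : schwartz_base U -> U 0.
Proof.
move=> [N [e [e0 ->]]] m n x _ _.
have -> : derive1n n (0 : schwartz_space) = 0 :> (R -> R).
  have := schwartz_derive1n_lin (-1) n schwartz0 schwartz0.
  by rewrite scaleN1r addNr scaleN1r addNr => ->.
by rewrite mulr0 normr0 ltW.
Qed.

Let sbase_half U : schwartz_base U ->
  exists2 W, schwartz_base W & forall x y, W x -> W y -> U (x + y).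
Proof.
move=> [N [e [e0 ->]]]; exists (schwartz_ball N (e / 2)).
  by exists N, (e / 2); rewrite divr_gt0.
move=> s t hs ht m n x mN nN.
have ss : schwartz s by apply/asboolP; exact: (valP s).
have st : schwartz t by apply/asboolP; exact: (valP t).
have -> : derive1n n (s + t : schwartz_space) = derive1n n s + derive1n n t :> (R -> R).
  by have := schwartz_derive1n_lin 1 n ss st; rewrite !scale1r.
rewrite mulrDr (splitr e); apply: (le_trans (ler_normD _ _)).
by apply: lerD; [exact: hs|exact: ht].
Qed.

HB.instance Definition _ := Nbhs_isNbhsTopological.Build schwartz_space
  (translate_nbhs_filter sbase_n0 sbaseI sbase0)
  (translate_nbhs_singleton sbase0)
  (translate_nbhs_nbhs sbase_half).

Record tempered := Tempered {
  pairing :> {scalar schwartz_space};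
  _ : continuous (pairing : schwartz_space -> R) }.

HB.instance Definition _ := gen_eqMixin tempered.
HB.instance Definition _ := gen_choiceMixin tempered.

Lemma zero_pairing_continuous :
  continuous ((\0 : {scalar schwartz_space}) : schwartz_space -> R).
Proof. by move=> s; apply: cvg_cst; exact: (@nbhs_filter schwartz_space s). Qed.
HB.instance Definition _ := isPointed.Build tempered
  (Tempered zero_pairing_continuous).

Definition cylinders : set (set tempered) :=
  [set C | exists (s : schwartz_space) (A : set (measurableTypeR R)),
     measurable A /\ C = [set w : tempered | A (w s)]].

Definition white_space := g_sigma_algebraType cylinders.

End Schwartz.

Section WhiteNoise.
Variable R : realType.
Local Notation S := (schwartz_space R).
Local Notation W := (white_space R).
Local Notation borel_measure := {measure set (measurableTypeR R) -> \bar R}.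

Definition cintegral d (T : measurableType d) (m : {measure set T -> \bar R})
    (f : T -> R[i]) : R[i] :=
  (\int[m]_x complex.Re (f x)) +i* (\int[m]_x complex.Im (f x)).

Definition cis (t : R) : R[i] := cos t +i* sin t.

Definition fourier (s : S) (u : R) : R[i] :=
  cintegral (@lebesgue_measure R) (fun t => cis (- (u * t)) * (s t)%:C).

Definition spectral_dot (sigma : borel_measure) (s1 s2 : S) : R :=
  complex.Re (cintegral sigma (fun u => (fourier s1 u)^* * fourier s2 u)).

Definition white_noise_measure (sigma : borel_measure) (P : probability W R) :=
  forall s : S,
    (expR (- (2^-1 * \int[sigma]_u Normc.normc (fourier s u) ^+ 2)))%:C =
    cintegral P (fun w : W => cis ((w : tempered R) s)).

(* A real Hilbert space containing the image of the Schwartz space under an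
   isometry for [spectral_dot] (so null vectors go to 0) with dense range; such a
   space is unique up to a unique isomorphism compatible with the embeddings. *)
Record hilbert_completion (sigma : borel_measure) := HilbertCompletion {
  hc_space :> completeNormedModType R;
  hc_dot : {dot hc_space for @idfun R};
  hc_normE : forall v, `|v| ^+ 2 = hc_dot v v;
  hc_inj : {linear S -> hc_space};
  hc_dotE : forall s t, hc_dot (hc_inj s) (hc_inj t) = spectral_dot sigma s t;
  hc_dense : dense (range hc_inj) }.

Definition orthonormal_basis sigma (H : hilbert_completion sigma)
    (g : nat -> H) : Prop :=
  (forall i j, hc_dot H (g i) (g j) = (i == j)%:R) /\
  (forall v : H, series (fun n => hc_dot H v (g n) *: g n) @ \oo --> v).

(* [Q v] is a representative of the image of [v] in L^2(P); there is exactly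
   one such [Q] up to almost sure equality. *)
Definition isometric_extension sigma (P : probability W R)
    (H : hilbert_completion sigma) (Q : H -> W -> R) : Prop :=
  [/\ forall v, Q v \in Lfun P 2%:E,
      forall (a : R) (u v : H), Q (a *: u + v) = a *: Q u + Q v %[ae P],
      forall v, ('N[P]_2%:E[EFin \o Q v])%E = (`|v|)%:E
    & forall s : S,
        Q (hc_inj H s) = (fun w : W => (w : tempered R) s) %[ae P]].

Definition L2_limit (P : probability W R) (X : nat -> W -> R) (Y : W -> R) :=
  [/\ forall m, X m \in Lfun P 2%:E, Y \in Lfun P 2%:E
    & ('N[P]_2%:E[EFin \o (X m \- Y)%R])%E @[m --> \oo] --> 0%E].

End WhiteNoise.

Section Hermite.
Variable R : realType.

Definition hermite_fun (n : nat) (x : R) : R :=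
  (-1) ^+ n / (pi `^ 4^-1 * 2 `^ (n%:R / 2) * n`!%:R `^ 2^-1)
  * expR (x ^+ 2 / 2) * derive1n n (fun y : R => expR (- y ^+ 2)) x.

(* Differentiating He_n = (-1)^n e^(x^2/2) (d/dx)^n e^(-x^2/2) gives
   He_(n+1) = x He_n - He_n'. *)
Fixpoint prob_hermite (n : nat) : {poly R} :=
  if n is m.+1 then 'X * prob_hermite m - (prob_hermite m)^`() else 1.

Definition oint (f : R -> R) (a b : R) : R :=
  if a <= b then \int[@lebesgue_measure R]_(x in `[a, b]) f x
  else - \int[@lebesgue_measure R]_(x in `[b, a]) f x.

End Hermite.

Definition multiindex := {fsfun nat -> nat with 0%N}.

Section Kondratiev.
Variable R : realType.
Implicit Types (c f g : multiindex -> R) (k : nat) (alpha : multiindex).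

Definition multi_fact alpha : nat := (\prod_(n <- finsupp alpha) (alpha n)`!)%N.

Definition two_N alpha : R :=
  \prod_(n <- finsupp alpha) (2 * n.+1)%:R ^+ alpha n.

(* The formal series [\sum_alpha c_alpha H_alpha] is its coefficient family
   [c]; this is [||c||_{-k}^2]. *)
Definition kond_sqnorm k c : \bar R :=
  \esum_(alpha in [set: multiindex]) (c alpha ^+ 2 / two_N alpha ^+ k)%:E.

Definition kond_pred : {pred multiindex -> R} :=
  fun c => `[< exists k, (kond_sqnorm k c < +oo)%E >].

Lemma two_N_ge1 alpha : 1 <= two_N alpha.
Proof.
rewrite /two_N; elim/big_rec : _ => // n x _ x1.
by rewrite mulr_ege1// exprn_ege1// ler1n.
Qed.

Lemma kond_term_ge0 k c alpha : (0 <= (c alpha ^+ 2 / two_N alpha ^+ k)%:E)%E.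
Proof.
rewrite lee_fin divr_ge0 ?sqr_ge0// exprn_ge0//.
exact: le_trans (two_N_ge1 alpha).
Qed.

Lemma kond_sqnorm_ge0 k c : (0 <= kond_sqnorm k c)%E.
Proof. by apply: esum_ge0 => alpha _; exact: kond_term_ge0. Qed.

Lemma kond_sqnorm0 k : kond_sqnorm k 0 = 0%E.
Proof. by apply: esum1 => alpha _; rewrite expr0n mul0r. Qed.

Lemma kond_sqnorm_le k l c : (k <= l)%N -> (kond_sqnorm l c <= kond_sqnorm k c)%E.
Proof.
move=> kl; apply: le_esum => alpha _; rewrite lee_fin ler_wpM2l ?sqr_ge0//.
have t0 : 0 < two_N alpha by exact: lt_le_trans (two_N_ge1 alpha).
by rewrite lef_pV2 ?posrE ?exprn_gt0// ler_weXn2l// two_N_ge1.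
Qed.

Lemma kond_sqnormZ k (a : R) c :
  (kond_sqnorm k (a *: c)%R <= (a ^+ 2)%:E * kond_sqnorm k c)%E.
Proof.
apply: ge_ereal_sup => _ [X [finX _] <-].
rewrite (_ : (\sum_(x \in X) _)%E =
    ((a ^+ 2)%:E * \sum_(x \in X) (c x ^+ 2 / two_N x ^+ k)%:E)%E); last first.
  rewrite ge0_mule_fsumr; last by move=> x; exact: kond_term_ge0.
  apply: eq_fsbigr => x _; rewrite -EFinM; congr EFin.
  by rewrite -[(a *: c) x]/(a * c x); ring.
apply: lee_wpmul2l; first by rewrite lee_fin sqr_ge0.
by apply: ereal_sup_ubound; exists X.
Qed.

Lemma kond_sqnormD k f g :
  (kond_sqnorm k (f + g)%R <= 2%:E * kond_sqnorm k f + 2%:E * kond_sqnorm k g)%E.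
Proof.
have E (x : \bar R) : (0 <= x)%E -> (2%:E * x = x + x)%E.
  by move=> x0; rewrite (_ : 2%:E = (1 + 1)%E)// ge0_muleDl// !mul1e.
rewrite !E ?kond_sqnorm_ge0// -!esumD; try by move=> x _;
  do ?[apply: adde_ge0]; exact: kond_term_ge0.
apply: le_esum => x _; rewrite -!EFinD lee_fin -!mulrDl ler_wpM2r//.
  by rewrite invr_ge0 exprn_ge0// (le_trans _ (two_N_ge1 x)).
rewrite -[(f + g) x]/(f x + g x) -subr_ge0.
rewrite [leRHS](_ : _ = (f x - g x) ^+ 2) ?sqr_ge0//; ring.
Qed.

Lemma kond_submod_closed : submod_closed kond_pred.
Proof.
split=> [|a f g]; rewrite !unfold_in.
  by apply/asboolP; exists 0%N; rewrite kond_sqnorm0 ltry.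
move=> /asboolP[k fk] /asboolP[l gl]; apply/asboolP; exists (maxn k l).
apply: le_lt_trans (kond_sqnormD _ _ _) _; apply: lte_add_pinfty.
  apply: lte_mul_pinfty => //; apply: le_lt_trans (kond_sqnormZ _ _ _) _.
  apply: lte_mul_pinfty; rewrite ?lee_fin ?sqr_ge0//.
  by apply: le_lt_trans fk; apply: kond_sqnorm_le; exact: leq_maxl.
apply: lte_mul_pinfty => //.
by apply: le_lt_trans gl; apply: kond_sqnorm_le; exact: leq_maxr.
Qed.
HB.instance Definition _ :=
  GRing.isSubmodClosed.Build R (multiindex -> R) kond_pred kond_submod_closed.

Record kondratiev :=
  Kondratiev { kond_coef :> multiindex -> R; _ : kond_coef \in kond_pred }.
HB.instance Definition _ := [isSub for kond_coef].
HB.instance Definition _ := [Choice of kondratiev by <:].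
HB.instance Definition _ := [SubChoice_isSubLmodule of kondratiev by <:].

Definition abs_convex (U : set kondratiev) : Prop :=
  forall (a b : R) (x y : kondratiev),
    `|a| + `|b| <= 1 -> U x -> U y -> U (a *: x + b *: y).

(* The finest locally convex topology for which all the inclusions
   [H_k -> K'] are continuous: a base at 0 is given by the absolutely convex
   sets whose trace on every [H_k] contains a ball of [H_k]. *)
Definition kond_base : set_system kondratiev :=
  [set U | abs_convex U /\
    forall k, exists e : R, 0 < e /\
      forall f : kondratiev, (kond_sqnorm k f < (e ^+ 2)%:E)%E -> U f].

Definition kond_nbhs := translate_nbhs kond_base.
HB.instance Definition _ := hasNbhs.Build kondratiev kond_nbhs.

Let kbase_n0 : exists U, kond_base U.
Proof. by exists setT; split=> // k; exists 1. Qed.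

Let kbaseI U V : kond_base U -> kond_base V ->
  exists2 X, kond_base X & X `<=` U `&` V.
Proof.
move=> [cU bU] [cV bV]; exists (U `&` V) => //; split.
  by move=> a b x y ab [Ux Vx] [Uy Vy]; split; [exact: cU|exact: cV].
move=> k; have [e [e0 eU]] := bU k; have [d [d0 dV]] := bV k.
exists (Num.min e d); split=> [|f fed]; first by rewrite lt_min e0.
have m0 : 0 <= Num.min e d by rewrite le_min !ltW.
split.
  apply: eU; apply: lt_le_trans fed _; rewrite lee_fin lerXn2r ?nnegrE ?(ltW e0)//.
  by rewrite ge_min lexx.
apply: dV; apply: lt_le_trans fed _; rewrite lee_fin lerXn2r ?nnegrE ?(ltW d0)//.
by rewrite ge_min lexx orbT.
Qed.

Let kbase0 U : kond_base U -> U 0.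
Proof.
move=> [_ /(_ 0%N)[e [e0]]]; apply.
by rewrite kond_sqnorm0 lte_fin exprn_gt0.
Qed.

Let kbase_half U : kond_base U ->
  exists2 V, kond_base V & forall x y, V x -> V y -> U (x + y).
Proof.
move=> [cU bU]; exists [set v | U (2 *: v)]; last first.
  move=> x y /= Ux Uy.
  have -> : x + y = 2^-1 *: (2 *: x) + 2^-1 *: (2 *: y).
    by rewrite !scalerA mulVf ?scale1r// pnatr_eq0.
  by apply: cU => //; rewrite ger0_norm//; lra.
split=> [a b x y ab /= Ux Uy|k].
  by rewrite scalerDr !scalerA ![2 * _]mulrC -!scalerA; exact: cU.
have [e [e0 eU]] := bU k; exists (e / 2); split; first by rewrite divr_gt0.
move=> f fe /=; apply: eU; apply: le_lt_trans (kond_sqnormZ k 2 f) _.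
rewrite muleC -lte_pdivlMr ?exprn_gt0//.
by apply: lt_le_trans fe _; rewrite -EFinM lee_fin exprMn exprVn.
Qed.

HB.instance Definition _ := Nbhs_isNbhsTopological.Build kondratiev
  (translate_nbhs_filter kbase_n0 kbaseI kbase0)
  (translate_nbhs_singleton kbase0)
  (translate_nbhs_nbhs kbase_half).

Local Notation W := (white_space R).

Definition wick_basis (Z : nat -> W -> R) alpha (w : W) : R :=
  \prod_(n <- finsupp alpha) (prob_hermite R (alpha n)).[Z n w].

(* [x] is the image of [X : L^2(P)] under the inclusion of [L^2(P)] in K': its
   coefficients are those of the orthogonal expansion of [X] on the [H_alpha],
   where [||H_alpha||^2 = alpha!]. *)
Definition L2_distribution (P : probability W R) (Z : nat -> W -> R)
    (X : W -> R) (x : kondratiev) : Prop :=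
  X \in Lfun P 2%:E /\
  forall alpha, x alpha =
    (\int[P]_w (X w * wick_basis Z alpha w)) / (multi_fact alpha)%:R.

(* The pair [(x, y)] is [x e_+ + y e_-], with the product topology. *)
Definition hkondratiev : Type := kondratiev * kondratiev.
HB.instance Definition _ := Topological.copy hkondratiev (kondratiev * kondratiev)%type.
HB.instance Definition _ := GRing.Zmodule.copy hkondratiev (kondratiev * kondratiev)%type.

Definition hscale (h : hyp R) (x : hkondratiev) : hkondratiev :=
  (lam1 h *: x.1, lam2 h *: x.2).

Lemma hscaleA (a b : hyp R) x : hscale a (hscale b x) = hscale (a * b) x.
Proof.
rewrite /hscale /= !scalerA; congr pair; congr (_ *: _);
  rewrite /lam1 /lam2 /=; ring.
Qed.
Lemma hscale1 : left_id 1 hscale.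
Proof.
by case=> x y; rewrite /hscale /lam1 /lam2 /= addr0 subr0 !scale1r.
Qed.
Lemma hscaleDr : right_distributive hscale +%R.
Proof. by move=> a x y; rewrite /hscale /= !scalerDr. Qed.
Lemma hscaleDl x : {morph hscale^~ x : a b / a + b}.
Proof.
move=> a b; rewrite /hscale; congr pair; rewrite -scalerDl; congr (_ *: _);
  rewrite /lam1 /lam2 /=; ring.
Qed.
HB.instance Definition _ := GRing.Zmodule_isLmodule.Build (hyp R) hkondratiev
  hscaleA hscale1 hscaleDr hscaleDl.

End Kondratiev.

(* Main.v *)
(** Since P_sigma has characteristic functional exp (- |s|^2 / 2) and S is dense in
H(sigma), every Q v is a centred Gaussian variable of variance |v|^2, so that the Z_n are
independent standard Gaussians; hence E[Z_n H_alpha] = 1 if alpha = eps_n and 0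
otherwise. An element sum b_n Z_n of the first chaos is therefore the distribution with
coefficient b_n at eps_n, with squared norm sum b_n^2 (2(n+1))^-k in H_k.

The estimates on Hermite functions come from the oscillator equation
zeta_n'' = (x^2 - 2n - 1) zeta_n: the energy F_n = zeta_n'^2 + (2n+1) zeta_n^2 satisfies
|F_n'| <= x^2 F_n, and F_n(0) = O(sqrt n), so locally uniformly zeta_n^2 and zeta_n'^2 are
O(sqrt n), while the primitive of zeta_n is O(n^(-3/4)). Square summability of the
primitives gives B_p, and the bound on zeta_n' gives the derivative in H_2 through the
mean value theorem, separately in the two idempotent components. *)

Require Import Defs.
From HB Require Import structures.
From mathcomp Require Import all_boot all_order all_algebra finmap complex ring lra.
From mathcomp Require Import all_classical all_reals all_analysis.
From mathcomp Require Import measurable_realfun.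

Set Implicit Arguments.
Unset Strict Implicit.
Unset Printing Implicit Defensive.

Import Order.TTheory GRing.Theory Num.Def Num.Theory.
Import numFieldNormedType.Exports.

Local Open Scope classical_set_scope.
Local Open Scope ring_scope.

(** * Hermite functions *)

(** The hypothesis on [P] speaks only of integrals of e^{i<w,s>}, so neither a Gaussian density nor
    a product structure is at hand. Every probabilistic fact is drawn from integrals of Y cos(t X +
    th): the free phase th carries the sine part as well, a derivative in t is a shift of th by
    pi/2, and t = th = 0 after k derivatives gives moments. The obstacle is that differentiating
    requires integrable powers of X, which are not given; they are gained two orders at a time from
    second differences of t -> E[X^(2k) cos(t X)]. Independence enters only as factorization of such
    integrals. In K' a single weighted norm suffices for each limit, and the norms differ: for the
    difference quotient the smallness is the factor t^2 of the increment, and H_2 is enough to sum a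
    growth of order sqrt n; for the partial sums of N_p it must come from the weights, so one more
    power is spent and the tails are measured in H_3. *)

Section RealAnalysis.
Variable R : realType.
Implicit Types (f F : R -> R) (p : {poly R}).

Lemma is_derive_continuous f (df : R -> R) :
  (forall x, is_derive x (1:R) f (df x)) -> continuous f.
Proof.
move=> H x; apply: differentiable_continuous; apply/derivable1_diffP.
by have [] := H x.
Qed.

(** The endpoints may come in either order because later increments have arbitrary sign; the bound
    on c keeps it in any ball around a that contains b. *)
Lemma is_derive_mean_value f (df : R -> R) (a b : R) :
  (forall x, is_derive x (1:R) f (df x)) ->
  exists2 c, `|c - a| <= `|b - a| & f b - f a = df c * (b - a).
Proof.
move=> H; have cf := is_derive_continuous H.
have [ab|/ltW ba] := leP a b.
  have [c] := @MVT_segment R f df a b ab (fun x _ => H x)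
    (continuous_subspaceT cf).
  rewrite in_itv/= => /andP[ac cb] E; exists c => //.
  by rewrite !ger0_norm ?subr_ge0// lerB.
have [c] := @MVT_segment R f df b a ba (fun x _ => H x)
    (continuous_subspaceT cf).
rewrite in_itv/= => /andP[bc ca] E; exists c => //.
  by rewrite !ler0_norm ?subr_le0// lerN2 lerB.
by rewrite -opprB E -mulrN opprB.
Qed.

Lemma ge0_derive_homo f (df : R -> R) :
  (forall x, is_derive x (1:R) f (df x)) -> (forall x, 0 <= df x) ->
  {homo f : x y / x <= y}.
Proof.
move=> H d0 x y xy; have [c _ E] := is_derive_mean_value x y H.
by rewrite -subr_ge0 E mulr_ge0// subr_ge0.
Qed.

(** Serves with a = -1 for the derivatives of e^(-x^2), and with a = -1/2 for zeta_n, for zeta_n'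
    and for the derivatives of the Gaussian characteristic function. *)
Lemma is_derive_poly_expR p (a x : R) :
  is_derive x (1:R) (fun y => p.[y] * expR (a * y ^+ 2))
    ((p^`() + (2 * a) *: ('X * p)).[x] * expR (a * x ^+ 2)).
Proof.
have h : is_derive x (1:R) (fun y => expR (a * y ^+ 2)) (2 * a * x * expR (a * x ^+ 2)).
  apply: (@is_derive_eq _ _ _ _ _ _ _ (expR (a * x ^+ 2) * (a * (2%:R * x)))).
    apply: (is_derive1_comp (f := expR) (g := fun y => a * y ^+ 2)).
    rewrite (_ : (fun y => _) = horner (a *: 'X^2)); last first.
      by apply/funext => y; rewrite !hornerE.
    apply: (is_derive_eq (is_derive_poly _ _)).
    by rewrite derivZ derivXn !hornerE/=; ring.
  by ring.
apply: (is_derive_eq (is_deriveM (is_derive_poly p x) h)).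
rewrite !hornerE /GRing.scale/=; ring.
Qed.

(** Near x, [oint f 0 y] is the integral from -M to y minus the one from -M to 0, whatever the sign
    of y. As -M lies below both 0 and x, the fundamental theorem is applied to a right endpoint
    only. *)
Lemma is_derive_oint f : continuous f -> forall x, is_derive x (1:R) (oint f 0) (f x).
Proof.
move=> cf x; pose M := `|x| + 1.
have fint a b : (@lebesgue_measure R).-integrable `[a, b] (EFin \o f).
  apply: continuous_compact_integrable; first exact: segment_compact.
  exact: continuous_subspaceT.
have M0 : - M < 0 by rewrite oppr_lt0 ltr_wpDl.
have Mx : - M < x.
  by rewrite ltrNl; apply: le_lt_trans (_ : `|x| < _); rewrite ?ltrDl// -normrN ler_norm.
have E y : - M < y -> oint f 0 y = \int[@lebesgue_measure R]_(t in `[- M, y]) f t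
    - \int[@lebesgue_measure R]_(t in `[- M, 0]) f t.
  move=> My; rewrite /oint; case: ifPn => [y0|]; last rewrite -ltNge => /ltW y0.
    rewrite Rintegral_itvB//= ?bnd_simp ?(ltW M0)//.
    rewrite Rintegral_itv_obnd_cbnd//.
    by apply: integrableS (fint 0 y) => //; exact: subset_itv_oc_cc.
  apply/eqP; rewrite eqr_oppLR opprB; apply/eqP.
  rewrite Rintegral_itvB//= ?bnd_simp ?(ltW My)//.
  rewrite Rintegral_itv_obnd_cbnd//.
  by apply: integrableS (fint y 0) => //; exact: subset_itv_oc_cc.
have xu : x < x + 1 by rewrite ltrDl.
have [dF EF] := continuous_FTC1_closed xu (fint (- M) _) Mx (cf x).
apply: (@near_eq_is_derive _ _ _ (fun y => \int[@lebesgue_measure R]_(t in `[- M, y]) f t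
    - \int[@lebesgue_measure R]_(t in `[- M, 0]) f t)).
  by near=> y; rewrite E//; near: y; exact: lt_nbhsr.
rewrite -[f x]subr0.
apply: is_deriveB.
by rewrite -EF derive1E; exact: derivableP.
Unshelve. all: by end_near. Qed.

Lemma is_derive_expR_cube (s x : R) :
  is_derive x (1:R) (fun y => expR (s * y ^+ 3)) (3 * s * x ^+ 2 * expR (s * x ^+ 3)).
Proof.
apply: (@is_derive_eq _ _ _ _ _ _ _ (expR (s * x ^+ 3) * (s * (3%:R * x ^+ 2)))); last ring.
apply: (is_derive1_comp (f := expR) (g := fun y => s * y ^+ 3)).
rewrite (_ : (fun y => _) = horner (s *: 'X^3)); last first.
  by apply/funext => y; rewrite !hornerE.
apply: (is_derive_eq (is_derive_poly _ _)).
by rewrite derivZ derivXn !hornerE/=; ring.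
Qed.

(* Energy estimate: F = u'^2 + c u^2 satisfies F' = 2 x^2 u u', hence
   |F'| <= x^2 F as soon as c >= 1. *)
Lemma oscillator_energy_le (c : R) (u u' : R -> R) : 1 <= c ->
  (forall x, is_derive x (1:R) u (u' x)) ->
  (forall x, is_derive x (1:R) u' ((x ^+ 2 - c) * u x)) ->
  forall x, u' x ^+ 2 + c * u x ^+ 2 <=
    (u' 0 ^+ 2 + c * u 0 ^+ 2) * expR (`|x| ^+ 3 / 3).
Proof.
move=> c1 du du' x; pose F := fun y => u' y ^+ 2 + c * u y ^+ 2.
have dF y : is_derive y (1:R) F (2 * y ^+ 2 * u y * u' y).
  have := is_deriveD (is_deriveX 2 (du' y)) (is_deriveZ c (is_deriveX 2 (du y))).
  move=> h; apply: (is_derive_eq h); rewrite /GRing.scale/= !expr1; ring.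
have key (s : R) y : is_derive y (1:R) (fun z => F z * expR (s * z ^+ 3))
    (y ^+ 2 * (2 * u y * u' y + 3 * s * F y) * expR (s * y ^+ 3)).
  apply: (is_derive_eq (is_deriveM (dF y) (is_derive_expR_cube s y))).
  rewrite /GRing.scale/=; ring.
have Fge y : `|2 * u y * u' y| <= F y.
  rewrite ler_norml; apply/andP; split; rewrite -subr_ge0.
    rewrite (_ : _ - _ = (u y + u' y) ^+ 2 + (c - 1) * u y ^+ 2); last by rewrite /F; ring.
    by rewrite addr_ge0 ?sqr_ge0// mulr_ge0 ?sqr_ge0// subr_ge0.
  rewrite (_ : _ - _ = (u y - u' y) ^+ 2 + (c - 1) * u y ^+ 2); last by rewrite /F; ring.
  by rewrite addr_ge0 ?sqr_ge0// mulr_ge0 ?sqr_ge0// subr_ge0.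
(* The integrating factor is e^(s x^3) with s = -1/3 to the right of 0, where the product decreases,
   and s = 1/3 to the left, where it increases. *)
have [x0|/ltW x0] := leP 0 x.
  have := @ge0_derive_homo (fun z => - (F z * expR (- 3^-1 * z ^+ 3)))
    (fun y => - (y ^+ 2 * (2 * u y * u' y + 3 * (- 3^-1) * F y) * expR (- 3^-1 * y ^+ 3))).
  move=> /(_ (fun y => is_deriveN (key _ y))) /(_ _ 0 x x0).
  rewrite lerN2 expr0n/= mulr0 expR0 mulr1 => H.
  rewrite ger0_norm//.
  have := H _; rewrite (_ : x ^+ 3 / 3 = - (- 3^-1 * x ^+ 3)); last by field.
  rewrite expRN ler_pdivlMr ?expR_gt0//; apply => y.
  rewrite -mulNr mulr_ge0 ?expR_ge0// -mulrN mulr_ge0 ?sqr_ge0// oppr_ge0.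
  rewrite (_ : _ + _ = 2 * u y * u' y - F y); last by field.
  by rewrite subr_le0 (le_trans (ler_norm _)).
have /(_ _ x 0 x0) := @ge0_derive_homo _ _ (key 3^-1).
rewrite expr0n/= mulr0 expR0 mulr1 => H.
rewrite ler0_norm// (_ : _ ^+ 3 / 3 = - (3^-1 * x ^+ 3)); last by field.
rewrite expRN ler_pdivlMr ?expR_gt0//; apply: H => y.
rewrite mulr_ge0 ?expR_ge0// mulr_ge0 ?sqr_ge0//.
have := Fge y; rewrite ler_norml => /andP[+ _].
by rewrite mulfV ?pnatr_eq0// mul1r -subr_ge0 opprK.
Qed.
End RealAnalysis.

(** * Hermite polynomials, the oscillator equation and bounds on Hermite functions *)

Section Hermite.
Variable R : realType.

Fixpoint phys_hermite (n : nat) : {poly R} :=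
  if n is m.+1 then 2 *: ('X * phys_hermite m) - (phys_hermite m)^`() else 1.

Lemma phys_hermiteS n :
  phys_hermite n.+1 = 2 *: ('X * phys_hermite n) - (phys_hermite n)^`().
Proof. by []. Qed.

Lemma deriv_phys_hermite n :
  (phys_hermite n.+1)^`() = (2 * n.+1%:R) *: phys_hermite n.
Proof.
elim: n => [|n IHn].
  by rewrite /= derivB derivZ derivM derivX derivC deriv0 -!mul_polyC; ring.
rewrite phys_hermiteS derivB derivZ derivM derivX mul1r.
rewrite IHn derivZ [(phys_hermite n)^`()](_ : _ = 2 *: ('X * phys_hermite n) - phys_hermite n.+1).
  by rewrite -!mul_polyC !polyCM !polyC_natr; ring.
by rewrite /= opprB addrC subrK.
Qed.

(** Differentiating the recurrence for H_(n+1) and comparing with H_(n+1)' = 2(n+1) H_n gives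
    Hermite's equation. *)
Lemma phys_hermite_ode n : (phys_hermite n)^`()^`() - 2 *: ('X * (phys_hermite n)^`()) =
  - (2 * n%:R) *: phys_hermite n.
Proof.
have := deriv_phys_hermite n; rewrite [phys_hermite n.+1]/= derivB derivZ derivM derivX mul1r.
move=> /(canRL (subrK _)) E.
have -> : (phys_hermite n)^`()^`() = 2 *: (phys_hermite n + 'X * (phys_hermite n)^`()) -
  (2 * n.+1%:R) *: phys_hermite n by rewrite E addrC addKr.
by rewrite -!mul_polyC !(polyCN, polyCM, polyC_natr); ring.
Qed.

Lemma derive1n_gaussian n : derive1n n (fun y : R => expR (- y ^+ 2)) =
  fun x => (-1) ^+ n * ((phys_hermite n).[x] * expR (- x ^+ 2)).
Proof.
elim: n => [|n IHn]; first by apply/funext => x/=; rewrite hornerC !mul1r.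
apply/funext => x; rewrite derive1nS IHn derive1E.
have := is_deriveZ ((-1) ^+ n) (is_derive_poly_expR (phys_hermite n) (-1) x).
rewrite (_ : _ \*: _ = fun x => (-1) ^+ n * ((phys_hermite n).[x] * expR (- x ^+ 2))).
  move=> [_ ->]; rewrite [phys_hermite n.+1]/= !hornerE exprS /GRing.scale/=.
  rewrite (_ : -1 * x * x = - x ^+ 2); ring.
apply/funext => y.
by rewrite -[LHS]/((-1) ^+ n * ((phys_hermite n).[y] * expR (-1 * y ^+ 2))) mulN1r.
Qed.

Definition hermite_norm n : R :=
  (pi `^ 4^-1 * 2 `^ (n%:R / 2) * n`!%:R `^ 2^-1)^-1.

(** Squaring turns the real powers of 2 and n! into integer ones, and the remaining sqrt pi cancels
    in the ratio. *)
Lemma hermite_normS n : hermite_norm n.+1 ^+ 2 = hermite_norm n ^+ 2 / (2 * n.+1%:R).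
Proof.
have E m : hermite_norm m ^+ 2 = (pi `^ 2^-1 * 2 ^+ m * m`!%:R)^-1.
  rewrite /hermite_norm exprVn !exprMn -!powR_mulrn ?powR_ge0// -!powRrM.
  rewrite (_ : 4^-1 * 2 = 2^-1 :> R); last by field.
  by rewrite mulVf ?pnatr_eq0// powRr1// divfK ?pnatr_eq0// powR_mulrn.
rewrite !E exprS factS natrM !invfM; ring.
Qed.

Lemma hermite_funE n : hermite_fun n =
  fun x : R => hermite_norm n * ((phys_hermite n).[x] * expR (- 2^-1 * x ^+ 2)).
Proof.
apply/funext => x; rewrite /hermite_fun derive1n_gaussian.
rewrite (_ : - 2^-1 * x ^+ 2 = x ^+ 2 / 2 + - x ^+ 2); last by field.
rewrite expRD -/(hermite_norm n).
have -> : (-1) ^+ n / (pi `^ 4^-1 * 2 `^ (n%:R / 2) * n`!%:R `^ 2^-1) =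
  (-1) ^+ n * hermite_norm n by [].
rewrite [LHS](_ : _ = ((-1) ^+ n * (-1) ^+ n) * (hermite_norm n *
  ((phys_hermite n).[x] * (expR (x ^+ 2 / 2) * expR (- x ^+ 2))))); last ring.
by rewrite -expr2 sqrr_sign mul1r.
Qed.

Definition hermite_fun' n (x : R) := hermite_norm n *
  (((phys_hermite n)^`() - 'X * phys_hermite n).[x] * expR (- 2^-1 * x ^+ 2)).

Lemma is_derive_hermite_fun n x :
  is_derive x (1:R) (hermite_fun n) (hermite_fun' n x).
Proof.
rewrite hermite_funE.
apply: (is_derive_eq (is_deriveZ _ (is_derive_poly_expR (phys_hermite n) (- 2^-1) x))).
rewrite /hermite_fun' !hornerE /GRing.scale/=; by field.
Qed.

Lemma is_derive_hermite_fun' n x :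
  is_derive x (1:R) (hermite_fun' n) ((x ^+ 2 - (2 * n%:R + 1)) * hermite_fun n x).
Proof.
have := is_deriveZ (hermite_norm n) (is_derive_poly_expR
  ((phys_hermite n)^`() - 'X * phys_hermite n) (- 2^-1) x).
move=> h; apply: (is_derive_eq h).
have /(congr1 (horner^~ x)) := phys_hermite_ode n.
rewrite hermite_funE derivB derivM derivX mul1r !hornerE /GRing.scale/= => H.
rewrite [X in _ * (X * _)](_ : _ = (x ^+ 2 - (2 * n%:R + 1)) * (phys_hermite n).[x]).
  ring.
move: H; set a := _^`()^`().[x]; set b := _^`().[x]; set e := (phys_hermite n).[x] => H.
have -> : a = 2 * (x * b) - 2 * n%:R * e by rewrite -mulNr -H; ring.
by field.
Qed.

Lemma phys_hermite0 n : (phys_hermite n.+2).[0] = - (2 * n.+1%:R) * (phys_hermite n).[0].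
Proof. rewrite phys_hermiteS deriv_phys_hermite hornerD hornerN !hornerZ hornerM hornerX.
by rewrite mul0r mulr0 sub0r mulNr. Qed.

(** This is zeta_n(0)^2. *)
Let a n : R := (hermite_norm n * (phys_hermite n).[0]) ^+ 2.

Let aS n : a n.+2 = n.+1%:R / n.+2%:R * a n.
Proof.
rewrite /a exprMn phys_hermite0 (hermite_normS n.+1) (hermite_normS n) [in RHS]exprMn.
move: (hermite_norm n ^+ 2) (phys_hermite n).[0] => u v.
have n1 : n.+1%:R != 0 :> R by rewrite pnatr_eq0.
have n2 : n.+2%:R != 0 :> R by rewrite pnatr_eq0.
move: n.+1%:R n.+2%:R n1 n2 => b c b0 c0.
by field; rewrite ?b0 ?c0.
Qed.

(** Induction by steps of two, following [aS], with a 1 = 0. The step amounts to sqrt((n+1)(n+3)) <=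
    n+2. *)
Let a_le n : a n <= a 0 / Num.sqrt n.+1%:R.
Proof.
elim/ltn_ind: n => -[_|[_|n IHn]].
- by rewrite sqrtr1 divr1.
- rewrite {1}/a phys_hermiteS derivC subr0 hornerZ hornerM hornerX mul0r !mulr0 expr0n/=.
  by rewrite divr_ge0 ?sqr_ge0// sqrtr_ge0.
rewrite aS; apply: (@le_trans _ _ (n.+1%:R / n.+2%:R * (a 0 / Num.sqrt n.+1%:R))).
  by rewrite ler_wpM2l// IHn.
rewrite mulrCA ler_wpM2l ?sqr_ge0//.
have p1 m : 0 < Num.sqrt m.+1%:R :> R by rewrite sqrtr_gt0.
have p2 m : m.+1%:R = Num.sqrt m.+1%:R ^+ 2 :> R by rewrite sqr_sqrtr.
rewrite -[leRHS]mul1r ler_pdivlMr//.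
rewrite mulrAC ler_pdivrMr// mul1r mulrAC ler_pdivrMr//.
rewrite [X in X * _ <= _]p2 expr2 -mulrA ler_wpM2l ?sqrtr_ge0//.
rewrite -sqrtrM// -[leRHS]ger0_norm// -sqrtr_sqr ler_wsqrtr//.
by rewrite -(natr1 n.+2) -(natr1 n.+1) -(natr1 n); nra.
Qed.

(** Since H_n' = 2n H_(n-1), zeta_n'(0)^2 equals 2n zeta_(n-1)(0)^2, so [a_le] controls both terms
    of the energy. Each is at most 2 a_0 sqrt(n+1), whence the factor 4. *)
Lemma hermite_energy0_le n :
  hermite_fun' n 0 ^+ 2 + (2 * n%:R + 1) * hermite_fun n 0 ^+ 2 <=
  4 * hermite_norm 0 ^+ 2 * Num.sqrt n.+1%:R.
Proof.
have p1 m : 0 < Num.sqrt m.+1%:R :> R by rewrite sqrtr_gt0.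
have p2 m : m.+1%:R = Num.sqrt m.+1%:R ^+ 2 :> R by rewrite sqr_sqrtr.
have a0 : a 0 = hermite_norm 0 ^+ 2 by rewrite /a hornerC mulr1.
have zE m : hermite_fun m 0 ^+ 2 = a m.
  by rewrite hermite_funE expr0n/= mulr0 expR0 mulr1.
rewrite zE.
have -> : hermite_fun' n 0 ^+ 2 = if n is m.+1 then 2 * m.+1%:R * a m else 0.
  rewrite /hermite_fun' expr0n/= mulr0 expR0 mulr1.
  case: n => [|n]; first by rewrite derivC sub0r hornerN hornerM hornerX mul0r oppr0 mulr0 expr0n.
  rewrite deriv_phys_hermite hornerD hornerN hornerM hornerX mul0r subr0 hornerZ.
  rewrite /a !exprMn hermite_normS.
  move: (hermite_norm n ^+ 2) (phys_hermite n).[0] => u v.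
  have n1 : n.+1%:R != 0 :> R by rewrite pnatr_eq0.
  move: n.+1%:R n1 => b b0.
  by field.
have a0ge0 : 0 <= a 0 by exact: sqr_ge0.
have le1 : (2 * n%:R + 1) * a n <= 2 * a 0 * Num.sqrt n.+1%:R.
  apply: (@le_trans _ _ (2 * n.+1%:R * a n)).
    by rewrite ler_wpM2r ?sqr_ge0// -natr1; lra.
  rewrite -mulrA -mulrA ler_wpM2l//.
  apply: (@le_trans _ _ (n.+1%:R * (a 0 / Num.sqrt n.+1%:R))).
    by rewrite ler_wpM2l// a_le.
  rewrite mulrCA ler_wpM2l// {1}p2 expr2 mulfK//; exact: lt0r_neq0.
have le2 : (if n is m.+1 then 2 * m.+1%:R * a m else 0) <= 2 * a 0 * Num.sqrt n.+1%:R.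
  case: n {le1} => [|n]; first by apply: mulr_ge0; [exact: mulr_ge0|exact: sqrtr_ge0].
  rewrite -mulrA -mulrA ler_wpM2l//.
  apply: (@le_trans _ _ (n.+1%:R * (a 0 / Num.sqrt n.+1%:R))).
    by rewrite ler_wpM2l// a_le.
  rewrite mulrCA ler_wpM2l// {1}p2 expr2 mulfK ?(lt0r_neq0)// ler_wsqrtr//.
  by rewrite ler_nat.
apply: (le_trans (lerD le2 le1)).
by rewrite -a0 -!mulrA -mulrDl -natrD.
Qed.

(** The constant of the energy at 0 times its largest growth factor on [-L, L]; it does not depend
    on n. *)
Definition hermite_bound (L : R) : R := 4 * hermite_norm 0 ^+ 2 * expR (L ^+ 3 / 3).

Lemma hermite_bound_ge0 L : 0 <= hermite_bound L.
Proof. by rewrite /hermite_bound mulr_ge0 ?expR_ge0// mulr_ge0 ?sqr_ge0. Qed.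

Lemma hermite_energy_le n (L x : R) : `|x| <= L ->
  hermite_fun' n x ^+ 2 + (2 * n%:R + 1) * hermite_fun n x ^+ 2 <=
  hermite_bound L * Num.sqrt n.+1%:R.
Proof.
move=> xL; have c1 : 1 <= 2 * n%:R + 1 :> R by rewrite lerDr mulr_ge0.
have := @oscillator_energy_le R _ _ _ c1 (is_derive_hermite_fun n)
  (is_derive_hermite_fun' n) x.
move=> /le_trans; apply; rewrite /hermite_bound [leRHS]mulrAC.
apply: ler_pM.
- by rewrite addr_ge0 ?sqr_ge0// mulr_ge0 ?sqr_ge0// (le_trans _ c1).
- exact: expR_ge0.
- exact: hermite_energy0_le.
- by rewrite ler_expR ler_wpM2r// lerXn2r// nnegrE// (le_trans _ xL).
Qed.

(** The factor 2n+1 enters only through 2n+1 >= 1, so that zeta_n and zeta_n' share one bound; the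
    weights of H_2 absorb its growth. *)
Lemma hermite_fun_sqr_le n (L x : R) : `|x| <= L ->
  hermite_fun n x ^+ 2 <= hermite_bound L * Num.sqrt n.+1%:R.
Proof.
move=> /(hermite_energy_le n); apply: le_trans; rewrite -[leLHS]add0r lerD ?sqr_ge0//.
by rewrite ler_peMl ?sqr_ge0// lerDr mulr_ge0.
Qed.

Lemma hermite_fun'_sqr_le n (L x : R) : `|x| <= L ->
  hermite_fun' n x ^+ 2 <= hermite_bound L * Num.sqrt n.+1%:R.
Proof.
move=> /(hermite_energy_le n); apply: le_trans; rewrite lerDl mulr_ge0 ?sqr_ge0//.
Qed.

Lemma hermite_fun_continuous n : continuous (hermite_fun n : R -> R).
Proof. exact: is_derive_continuous (@is_derive_hermite_fun n). Qed.

Lemma oint0 (f : R -> R) : oint f 0 0 = 0.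
Proof. by rewrite /oint lexx set_itv1 Rintegral_set1. Qed.

(* By the Hermite equation, (2n+1) I + zeta_n' has derivative x^2 zeta_n, where
   I x is the integral of zeta_n from 0 to x. *)
Lemma oint_hermite_le n (x : R) : oint (hermite_fun n) 0 x ^+ 2 <=
  (`|x| ^+ 3 + 2) ^+ 2 * hermite_bound `|x| / Num.sqrt n.+1%:R ^+ 3.
Proof.
set s := Num.sqrt _; set M := hermite_bound _.
have s0 : 0 < s by rewrite sqrtr_gt0.
have sE : s ^+ 2 = n.+1%:R by rewrite sqr_sqrtr.
have dI := is_derive_oint (@hermite_fun_continuous n).
have dD y : is_derive y (1:R)
    (fun y => (2 * n%:R + 1) * oint (hermite_fun n) 0 y + hermite_fun' n y)
    (y ^+ 2 * hermite_fun n y).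
  apply: (is_derive_eq (is_deriveD (is_deriveZ (2 * n%:R + 1) (dI y))
    (is_derive_hermite_fun' n y))).
  rewrite /GRing.scale/=; ring.
have [c] := is_derive_mean_value 0 x dD.
rewrite !subr0 oint0 mulr0 add0r => cx E.
pose q := Num.sqrt (M * s).
have qE : q ^+ 2 = M * s by rewrite sqr_sqrtr// mulr_ge0 ?hermite_bound_ge0// ltW.
have q0 : 0 <= q by exact: sqrtr_ge0.
have bnd (y z : R) : z ^+ 2 <= M * s -> `|z| <= q.
  by move=> h; rewrite -sqrtr_sqr ler_wsqrtr.
have b0 : `|hermite_fun n c| <= q by apply: bnd => //; exact: hermite_fun_sqr_le.
have b1 : `|hermite_fun' n x| <= q by apply: bnd => //; exact: hermite_fun'_sqr_le.
have b2 : `|hermite_fun' n 0| <= q.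
  by apply: bnd => //; apply: hermite_fun'_sqr_le; rewrite normr0.
(* The mean value term c^2 zeta_n(c) x contributes |x|^3 q, and the values of zeta_n' at x and at 0
   contribute q each. *)
have le1 : `|(2 * n%:R + 1) * oint (hermite_fun n) 0 x| <= (`|x| ^+ 3 + 2) * q.
  have -> : (2 * n%:R + 1) * oint (hermite_fun n) 0 x =
    c ^+ 2 * hermite_fun n c * x - hermite_fun' n x + hermite_fun' n 0 by rewrite -E; ring.
  rewrite (le_trans (ler_normD _ _))// (_ : _ * q = `|x| ^+ 2 * q * `|x| + q + q); last ring.
  rewrite lerD// (le_trans (ler_normB _ _))// lerD//.
  rewrite normrM ler_wpM2r// normrM ler_pM// normrX lerXn2r// nnegrE//.
(* Here 2n+1 >= n+1 = s^2; the resulting s^4 on the left against q^2 = M s on the right leaves the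
   s^(-3) of the conclusion. *)
have le2 : (n.+1%:R * `|oint (hermite_fun n) 0 x|) ^+ 2 <= ((`|x| ^+ 3 + 2) * q) ^+ 2.
  have nn : 0 <= n%:R :> R by [].
  rewrite lerXn2r ?nnegrE ?mulr_ge0 ?addr_ge0 ?exprn_ge0//.
  apply: le_trans le1; rewrite normrM ler_wpM2r// ger0_norm; rewrite -?natr1; lra.
rewrite ler_pdivlMr ?exprn_gt0//.
rewrite -(ler_pM2r s0) -mulrA -exprSr -/(s ^+ 4).
apply: le_trans (le_trans le2 _); last by rewrite exprMn qE mulrA.
by rewrite exprMn -sE -exprM real_normK ?num_real// mulrC.
Qed.

(** The quotient is zeta_n(c) for some c within |d| of x, and a second mean value writes zeta_n(c) -
    zeta_n(x) as zeta_n'(e) (c - x). The factor d^2 is the same for all n. *)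
Lemma oint_hermite_increment_le n (L x d : R) : `|x| + `|d| <= L -> d != 0 ->
  (d^-1 * (oint (hermite_fun n) 0 (x + d) - oint (hermite_fun n) 0 x)
    - hermite_fun n x) ^+ 2 <=
  d ^+ 2 * (hermite_bound L * Num.sqrt n.+1%:R).
Proof.
move=> xL d0.
have dI := is_derive_oint (@hermite_fun_continuous n).
have [c] := is_derive_mean_value x (x + d) dI.
rewrite addrAC subrr add0r => cx ->.
rewrite mulrC mulfK//.
have [e] := is_derive_mean_value x c (is_derive_hermite_fun n) => ex ->.
rewrite exprMn mulrC ler_pM ?sqr_ge0//.
  by rewrite -real_normK ?num_real// -[leRHS]real_normK ?num_real// lerXn2r ?nnegrE.
apply: hermite_fun'_sqr_le; apply: le_trans xL.
rewrite -[e](subrK x) addrC (le_trans (ler_normD _ _))// lerD2l.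
exact: le_trans ex cx.
Qed.
End Hermite.

(** * Gaussian moments *)

Section Trigonometry.
Variable R : realType.
Implicit Types x y : R.

Lemma cosDpihalf x : cos (x + pi / 2) = - sin x.
Proof. by rewrite cosD cos_pihalf sin_pihalf mulr0 mulr1 sub0r. Qed.

Lemma cosM x y : cos x * cos y = 2^-1 * (cos (x + y) + cos (x - y)).
Proof. by rewrite cosD cosB; field. Qed.

(** Written as a phase shift, the derivative stays in the family of cosines, so repeated
    differentiation never alternates with sines. *)
Lemma is_derive_cos_affine (a b t : R) :
  is_derive t (1:R) (fun s => cos (s * a + b)) (a * cos (t * a + b + pi / 2)).
Proof.
rewrite cosDpihalf.
have h : is_derive t (1:R) (fun s => s * a + b) a.
  rewrite (_ : (fun s => _) = horner (a *: 'X + b%:P)); last first.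
    by apply/funext => s; rewrite !hornerE mulrC.
  by apply: (is_derive_eq (is_derive_poly _ _)); rewrite derivD derivZ derivX derivC !hornerE.
apply: (is_derive_eq (is_derive1_comp (f := cos) (is_derive_cos _) h)).
by rewrite /GRing.scale/= mulrC.
Qed.

Lemma dist_cos_le x y : `|cos x - cos y| <= `|x - y|.
Proof.
have [c _ ->] := is_derive_mean_value y x (@is_derive_cos R).
by rewrite normrM normrN ler_piMl// sin_max.
Qed.

(** Replaces a possibly non-integrable factor X by bounded approximations, in view of Fatou's
    lemma. *)
Lemma cvg_mul_sin_div x : (fun n : nat => n.+1%:R * sin (x / n.+1%:R)) @ \oo --> x.
Proof.
have key (n : nat) : `|n.+1%:R * sin (x / n.+1%:R) - x| <= x ^+ 2 * n.+1%:R^-1.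
  have [c] := is_derive_mean_value 0 (x / n.+1%:R) (@is_derive_sin R).
  rewrite sin0 !subr0 => cx ->.
  rewrite [X in `|X|](_ : _ = x * (cos c - cos 0)); last first.
    by rewrite cos0; field; rewrite addrC natr1 pnatr_eq0.
  rewrite normrM -real_normK ?num_real// expr2 -mulrA ler_wpM2l//.
  rewrite (le_trans (dist_cos_le _ _))// subr0 (le_trans cx)//.
  by rewrite normrM [X in _ * X]gtr0_norm ?invr_gt0.
apply/subr_cvg0; apply: norm_cvg0.
have B : (fun n : nat => x ^+ 2 * n.+1%:R^-1) @ \oo --> (0:R).
  by rewrite -[0](mulr0 (x ^+ 2)); apply: cvgMr; exact: cvg_harmonic.
apply: (@squeeze_cvgr _ _ _ _ (cst 0) _ _ _ _ _ B) => //; last exact: cvg_cst.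
by apply: nearW => n; rewrite normr_ge0 key.
Qed.

(** The radius 2 covers all the points 2/(n+1) at which the increment is later taken. *)
Lemma quadratic_increment (f f1 f2 : R -> R) :
  (forall x, is_derive x (1:R) f (f1 x)) -> (forall x, is_derive x (1:R) f1 (f2 x)) ->
  continuous f2 -> f1 0 = 0 ->
  exists B : R, forall s, `|s| <= 2 -> `|f 0 - f s| <= B * s ^+ 2.
Proof.
move=> d1 d2 cf f10.
have [c _ cmax] := @EVT_max R (fun x => `|f2 x|) (-2) 2 ltac:(by lra)
  ltac:(by apply: continuous_subspaceT => x; apply: cvg_norm; exact: cf).
exists `|f2 c| => s s2.
have [x] := is_derive_mean_value 0 s d1.
have [y] := is_derive_mean_value 0 x d2.
rewrite !subr0 f10 subr0 => yx xE xs E.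
rewrite distrC E xE !normrM -[s ^+ 2]real_normK ?num_real// expr2 mulrA.
rewrite ler_wpM2r// ler_pM//; apply: cmax; rewrite in_itv/= -ler_norml.
exact: le_trans yx (le_trans xs s2).
Qed.

End Trigonometry.

(** * Cosine integrals, moments and Gaussian integration by parts *)

Section Probability.
Context d (T : measurableType d) (R : realType) (P : probability T R).
Implicit Types (X Y : T -> R) (p : {poly R}).
Local Notation int f := (P.-integrable setT (EFin \o f)).
Local Notation "''E' f" := (\int[P]_w f w) (at level 10, f at level 8).

Lemma le_integrable_fun X Y : measurable_fun setT X ->
  (forall w, `|X w| <= `|Y w|) -> int Y -> int X.
Proof.
move=> mX XY; apply: le_integrable => //; first exact/measurable_EFinP.
by move=> w _; rewrite /= lee_fin.
Qed.

Lemma integrable_measurable X : int X -> measurable_fun setT X.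
Proof. by case/integrableP => /measurable_EFinP. Qed.

Lemma integrable_cst (c : R) : int (cst c).
Proof.
apply: measurable_bounded_integrable => //.
  by rewrite (le_lt_trans (probability_le1 P measurableT))// ltry.
exact: bounded_cst.
Qed.

Lemma integrable_add X Y : int X -> int Y -> int (fun w => X w + Y w).
Proof. by move=> iX iY; exact: (integrableD measurableT iX iY). Qed.

Lemma integrable_sub X Y : int X -> int Y -> int (fun w => X w - Y w).
Proof. by move=> iX iY; exact: (integrableB measurableT iX iY). Qed.

Lemma integrable_scale (c : R) X : int X -> int (fun w => c * X w).
Proof. by move=> iX; exact: (integrableZl measurableT c iX). Qed.

Lemma measurable_cos_comp X (t th : R) : measurable_fun setT X ->
  measurable_fun setT (fun w => cos (t * X w + th)).
Proof.
move=> mX; apply: (measurableT_comp (f := cos)).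
  by apply: continuous_measurable_fun; exact: continuous_cos.
by apply: measurable_funD => //; exact: measurable_funM.
Qed.

Lemma integrable_mul_cos X Y (t th : R) : measurable_fun setT X -> int Y ->
  int (fun w => Y w * cos (t * X w + th)).
Proof.
move=> mX iY; apply: (le_integrable_fun _ _ iY).
  by apply: measurable_funM; [exact: integrable_measurable|exact: measurable_cos_comp].
by move=> w; rewrite normrM ler_piMr// cos_max.
Qed.

(** The t-derivative of the integrand is dominated by |Y X| for every t, because cosine is bounded
    by 1. *)
Lemma is_derive_integral_cos X Y (th t : R) : measurable_fun setT X ->
  int Y -> int (fun w => Y w * X w) ->
  is_derive t (1:R) (fun s => 'E (fun w => Y w * cos (s * X w + th)))
    ('E (fun w => Y w * X w * cos (t * X w + (th + pi / 2)))).
Proof.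
move=> mX iY iYX.
have dE s w : is_derive s (1:R) (fun s => Y w * cos (s * X w + th))
    (Y w * X w * cos (s * X w + (th + pi / 2))).
  apply: (is_derive_eq (is_deriveZ (Y w) (is_derive_cos_affine (X w) th s))).
  by rewrite /GRing.scale/= mulrA addrA.
have p1 s w : partial1of2 (fun s w => Y w * cos (s * X w + th)) s w =
    Y w * X w * cos (s * X w + (th + pi / 2)).
  by rewrite partial1of2E; have [_ ->] := dE s w.
pose f s w := Y w * cos (s * X w + th).
have It : `]t - 1, t + 1[%classic t by rewrite /= in_itv/=; apply/andP; split; lra.
have fint s : `]t - 1, t + 1[%classic s -> P.-integrable setT (EFin \o f s).
  by move=> _; exact: integrable_mul_cos.
have fder s w : `]t - 1, t + 1[%classic s -> setT w -> derivable (f ^~ w) s 1.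
  by move=> _ _; have [] := dE s w.
have G0 w : 0 <= `|Y w * X w| by [].
have Gi : P.-integrable setT (EFin \o (fun w => `|Y w * X w|)).
  exact: integrable_norm.
have Gu s w : `]t - 1, t + 1[%classic s -> setT w -> `|partial1of2 f s w| <= `|Y w * X w|.
  by move=> _ _; rewrite p1 normrM ler_piMr// cos_max.
have dd := derivable_under_integral measurableT It fint fder G0 Gi Gu.
have ee := differentiation_under_integral measurableT It fint fder G0 Gi Gu.
apply: DeriveDef => //; rewrite -derive1E ee.
by apply: eq_Rintegral => w _; rewrite p1.
Qed.

(** Unlike integrability, this property is stable under products, hence under polynomials;
    integrability conditions below follow from closure. *)
Definition all_moments X := measurable_fun setT X /\ forall k, int (fun w => X w ^+ k).

Lemma all_moments_integrable X : all_moments X -> int X.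
Proof. by move=> [_ /(_ 1%N)]. Qed.

Lemma all_moments_cst (c : R) : all_moments (cst c).
Proof. by split=> // k; apply: (integrable_cst (c ^+ k)). Qed.

Lemma all_moments_bounded X (M : R) : measurable_fun setT X ->
  (forall w, `|X w| <= M) -> all_moments X.
Proof.
move=> mX XM; split=> // k.
apply: (le_integrable_fun (measurable_funX k mX) _ (integrable_cst (M ^+ k))) => w.
rewrite !normrX lerXn2r// ?nnegrE// (le_trans (XM w))// ler_norm//.
Qed.

Lemma all_momentsM X Y : all_moments X -> all_moments Y ->
  all_moments (fun w => X w * Y w).
Proof.
move=> [mX iX] [mY iY]; split=> [|k]; first exact: measurable_funM.
apply: (le_integrable_fun _ _ (integrable_add (iX k.*2) (iY k.*2))).
  by apply: measurable_funX; exact: measurable_funM.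
move=> w; rewrite exprMn -!muln2 !exprM.
rewrite [leRHS]ger0_norm ?addr_ge0 ?sqr_ge0//.
move: (X w ^+ k) (Y w ^+ k) => a b; rewrite ler_norml.
by apply/andP; split; [have := sqr_ge0 (a + b)|have := sqr_ge0 (a - b)]; nra.
Qed.

Lemma all_momentsD X Y : all_moments X -> all_moments Y ->
  all_moments (fun w => X w + Y w).
Proof.
move=> hX hY; split=> [|k]; first exact: measurable_funD hX.1 hY.1.
have [mX iX] := hX; have [mY iY] := hY.
have iXY : int (fun w => `|X w ^+ k| + `|Y w ^+ k|).
  by apply: integrable_add; apply: integrable_norm.
apply: (le_integrable_fun _ _ (integrable_scale (2 ^+ k) iXY)).
  by apply: measurable_funX; exact: measurable_funD.
move=> w; rewrite [leRHS]ger0_norm ?mulr_ge0 ?addr_ge0 ?exprn_ge0//.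
wlog XY : X Y {mX mY iX iY hX hY iXY} / `|X w| <= `|Y w| => [H|].
  have [|/ltW YX] := leP `|X w| `|Y w|; first exact: H.
  by rewrite addrC [X in _ * X]addrC; exact: H.
apply: (@le_trans _ _ (2 ^+ k * `|Y w ^+ k|)); last by rewrite ler_wpM2l ?exprn_ge0// lerDr.
rewrite !normrX -exprMn lerXn2r// ?nnegrE ?mulr_ge0//.
by rewrite (le_trans (ler_normD _ _))// mulr_natl mulr2n lerD2r.
Qed.

Lemma all_moments_prod (I : Type) (s : seq I) (X : I -> T -> R) :
  (forall i, all_moments (X i)) -> all_moments (fun w => \prod_(i <- s) X i w).
Proof.
move=> hX; elim: s => [|i s IHs].
  rewrite (_ : (fun w => _) = cst 1); last by apply/funext => w; rewrite big_nil.
  exact: all_moments_cst.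
rewrite (_ : (fun w => _) = fun w => X i w * \prod_(i <- s) X i w).
  exact: all_momentsM.
by apply/funext => w; rewrite big_cons.
Qed.

Lemma all_moments_horner X p : all_moments X -> all_moments (fun w => p.[X w]).
Proof.
move=> hX; elim/poly_ind: p => [|p c IHp].
  rewrite (_ : (fun w => _) = cst 0); last by apply/funext => w; rewrite horner0.
  exact: all_moments_cst.
rewrite (_ : (fun w => _) = fun w => p.[X w] * X w + cst c w).
  by apply: all_momentsD; [exact: all_momentsM|exact: all_moments_cst].
by apply/funext => w; rewrite !hornerE.
Qed.

Lemma all_moments_cos X (t th : R) : measurable_fun setT X ->
  all_moments (fun w => cos (t * X w + th)).
Proof.
move=> mX; apply: (@all_moments_bounded _ 1) => [|w]; last exact: cos_max.
exact: measurable_cos_comp.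
Qed.

(* Each derivative in t brings down one factor X. *)
Lemma trig_moment_eq0 X Y : measurable_fun setT X ->
  (forall k, int (fun w => Y w * X w ^+ k)) ->
  (forall t th, 'E (fun w => Y w * cos (t * X w + th)) = 0) ->
  forall k t th, 'E (fun w => Y w * X w ^+ k * cos (t * X w + th)) = 0.
Proof.
move=> mX iYX E0; elim=> [|k IHk] t th.
  by under eq_Rintegral do rewrite mulr1; exact: E0.
have iYX' : int (fun w => Y w * X w ^+ k * X w).
  by under eq_fun do rewrite -mulrA -exprSr; exact: iYX.
have [_] := is_derive_integral_cos (th - pi / 2) t mX (iYX k) iYX'.
rewrite subrK (_ : (fun s => _) = cst 0); last by apply/funext => s; exact: IHk.
rewrite derive_cst => /esym H; rewrite -[RHS]H.
by apply: eq_Rintegral => w _; rewrite exprSr mulrA.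
Qed.

(** Orthogonality to all cosines of X passes to powers of X at t = th = 0, hence to polynomials. No
    density of trigonometric functions is involved. *)
Lemma moment_eq0 X Y p : measurable_fun setT X ->
  (forall k, int (fun w => Y w * X w ^+ k)) ->
  (forall t th, 'E (fun w => Y w * cos (t * X w + th)) = 0) ->
  'E (fun w => Y w * p.[X w]) = 0.
Proof.
move=> mX iYX E0.
have H k : 'E (fun w => Y w * X w ^+ k) = 0.
  rewrite -[RHS](trig_moment_eq0 mX iYX E0 k 0 0).
  by apply: eq_Rintegral => w _; rewrite mul0r addr0 cos0 mulr1.
have Hi k (q : {poly R}) : int (fun w => Y w * X w ^+ k * q.[X w]).
  elim/poly_ind: q k => [|q c IHq] k.
    by under eq_fun do rewrite horner0 mulr0; exact: (integrable_cst 0).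
  under eq_fun do rewrite !hornerE mulrDr (mulrC q.[_]) mulrA -[Y _ * _ * X _]mulrA -exprSr.
  apply: integrable_add; first exact: IHq.
  by under eq_fun do rewrite mulrC; exact: integrable_scale.
(* The extra X^k absorbs the factor split off at each step of p = q X + c. *)
suff H1 k : 'E (fun w => Y w * X w ^+ k * p.[X w]) = 0.
  by rewrite -[RHS](H1 0%N); apply: eq_Rintegral => w _; rewrite mulr1.
elim/poly_ind: p k => [|q c IHq] k.
  under eq_Rintegral do rewrite horner0 mulr0.
  by rewrite Rintegral_cst// mul0r.
transitivity ('E (fun w => Y w * X w ^+ k.+1 * q.[X w] + c * (Y w * X w ^+ k))).
  by apply: eq_Rintegral => w _; rewrite hornerD hornerM hornerX hornerC exprSr; ring.
rewrite RintegralD//; first by rewrite RintegralZl// IHq H mulr0 addr0.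
exact: integrable_scale.
Qed.

(** The real part of e^(i th) E[e^(i t X)]: th = 0 gives the cosine part and th = -pi/2 the
    vanishing sine part, without complex integrals. *)
Definition standard_gaussian X := measurable_fun setT X /\
  forall t th, 'E (fun w => cos (t * X w + th)) = cos th * expR (- 2^-1 * t ^+ 2).

Lemma prob_hermiteS n :
  prob_hermite R n.+1 = 'X * prob_hermite R n - (prob_hermite R n)^`().
Proof. by []. Qed.

Lemma deriv_prob_hermite n :
  (prob_hermite R n.+1)^`() = n.+1%:R *: prob_hermite R n.
Proof.
elim: n => [|n IHn]; first by rewrite /= derivB derivM derivX derivC -!mul_polyC; ring.
rewrite prob_hermiteS derivB derivM derivX mul1r.
rewrite IHn derivZ [(prob_hermite R n)^`()](_ : _ = 'X * prob_hermite R n - prob_hermite R n.+1).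
  by rewrite -!mul_polyC !polyC_natr; ring.
by rewrite /= opprB addrC subrK.
Qed.

Lemma prob_hermite0 n : (prob_hermite R n.+2).[0] = - n.+1%:R * (prob_hermite R n).[0].
Proof.
rewrite prob_hermiteS deriv_prob_hermite hornerD hornerN hornerZ hornerM hornerX.
by rewrite mul0r sub0r mulNr.
Qed.

(* The k-th derivative of exp (- t^2 / 2). *)
Let gmoment k (t : R) := (-1) ^+ k * ((prob_hermite R k).[t] * expR (- 2^-1 * t ^+ 2)).

Let is_derive_gmoment k t : is_derive t (1:R) (gmoment k) (gmoment k.+1 t).
Proof.
apply: (is_derive_eq (is_deriveZ _ (is_derive_poly_expR (prob_hermite R k) (- 2^-1) t))).
rewrite /gmoment [prob_hermite R k.+1]/= !hornerE exprS /GRing.scale/=.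
by field.
Qed.

(** The k-th t-derivative of the identity in [standard_gaussian]; each differentiation adds pi/2 to
    the phase on the left, which th - k pi/2 undoes on the right. *)
Let cos_moment X k := forall t th, 'E (fun w => X w ^+ k * cos (t * X w + th)) =
  cos (th - k%:R * (pi / 2)) * gmoment k t.

Let cos_momentS X k : measurable_fun setT X ->
  int (fun w => X w ^+ k) -> int (fun w => X w ^+ k.+1) ->
  cos_moment X k -> cos_moment X k.+1.
Proof.
move=> mX iX iXS H t th.
have iXS' : int (fun w => X w ^+ k * X w) by under eq_fun do rewrite -exprSr.
have [_] := is_derive_integral_cos (th - pi / 2) t mX iX iXS'.
rewrite subrK (_ : (fun s => _) = cos (th - pi / 2 - k%:R * (pi / 2)) \*: gmoment k); last first.
  by apply/funext => s; exact: H.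
have [_ ->] := is_deriveZ (cos (th - pi / 2 - k%:R * (pi / 2))) (is_derive_gmoment k t).
have -> : th - k.+1%:R * (pi / 2) = th - pi / 2 - k%:R * (pi / 2).
  by rewrite -natr1; ring.
move=> H2; rewrite [RHS]H2.
by apply: eq_Rintegral => w _; rewrite exprSr.
Qed.

(** The first-order term vanishes because Hermite polynomials of odd degree are 0 at 0. *)
Let quadratic_bound k : exists B : R, forall s, `|s| <= 2 ->
  `|gmoment k.*2 0 - gmoment k.*2 s| <= B * s ^+ 2.
Proof.
have g0 : gmoment k.*2.+1 0 = 0.
  rewrite /gmoment (_ : (prob_hermite R k.*2.+1).[0] = 0) ?mul0r ?mulr0//.
  elim: k => [|k IHk]; first by
    rewrite /= derivC hornerD hornerN hornerM hornerX mul0r horner0 subr0.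
  by rewrite doubleS prob_hermite0 IHk mulr0.
exact: quadratic_increment (is_derive_gmoment _) (is_derive_gmoment _)
  (is_derive_continuous (is_derive_gmoment _)) g0.
Qed.

(* Fatou's lemma for X^(2k) (n sin (X / n))^2, whose integral is a second difference of
   t |-> E[X^(2k) cos (t X)]. *)
Let gaussian_even_step X k : measurable_fun setT X ->
  int (fun w => X w ^+ k.*2) -> cos_moment X k.*2 -> int (fun w => X w ^+ k.+1.*2).
Proof.
move=> mX iX H; have [B HB] := quadratic_bound k.
pose f n w := X w ^+ k.*2 * (n.+1%:R * sin (X w / n.+1%:R)) ^+ 2.
have even m (x : R) : 0 <= x ^+ m.*2 by rewrite -muln2 exprM sqr_ge0.
have f0 n w : 0 <= f n w by rewrite mulr_ge0 ?even ?sqr_ge0.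
have fE n : f n = fun w => 2^-1 * n.+1%:R ^+ 2 *
    (X w ^+ k.*2 * cos (0 * X w + 0) - X w ^+ k.*2 * cos (2 / n.+1%:R * X w + 0)).
  apply/funext => w; rewrite mul0r !addr0 cos0 /f.
  have -> : 2 / n.+1%:R * X w = X w / n.+1%:R *+ 2 by rewrite -mulr_natl; ring.
  by rewrite cos_mulr2n cos2sin2; field.
have fi n : int (f n).
  rewrite fE; apply: integrable_scale.
  by apply: integrable_sub; exact: integrable_mul_cos.
(* With N = n+1, the product of N^2/2 and B (2/N)^2 is 2B for every n. *)
have fB n : 'E (f n) <= 2 * B.
  rewrite fE RintegralZl//; last by apply: integrable_sub; exact: integrable_mul_cos.
  rewrite RintegralB//; try exact: integrable_mul_cos.
  rewrite !H -mulrBr.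
  have n0 : 0 < n.+1%:R :> R by [].
  apply: (@le_trans _ _ (2^-1 * n.+1%:R ^+ 2 * (B * (2 / n.+1%:R) ^+ 2))).
    rewrite ler_wpM2l ?mulr_ge0//.
    rewrite (le_trans (ler_norm _))// normrM (le_trans _ (HB _ _))//.
      by rewrite ler_piMl// cos_max.
    by rewrite ger0_norm ?divr_ge0// ler_pdivrMr// ler_peMr// ler1n.
  rewrite le_eqVlt; apply/orP; left; apply/eqP; field.
  by rewrite addrC natr1 pnatr_eq0.
have mf n : measurable_fun setT (EFin \o f n).
  by apply/measurable_EFinP; exact: integrable_measurable (fi n).
have fe0 n w : setT w -> (0 <= (EFin \o f n) w)%E by rewrite lee_fin.
have mX2 : measurable_fun setT (fun w => X w ^+ k.+1.*2) by exact: measurable_funX.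
apply/integrableP; split; first exact/measurable_EFinP.
under eq_integral do rewrite /= ger0_norm//.
have := @fatou _ _ _ P _ measurableT _ mf fe0.
rewrite (eq_integral (fun w => (X w ^+ k.+1.*2)%:E)); last first.
  move=> w _; apply: (cvg_limn_einf_sup _).1.
  apply: cvg_EFin; first exact: nearW.
  rewrite doubleS -addn2 exprD; apply: cvgMr.
  by rewrite /comp/= expr2; apply: cvgM; exact: cvg_mul_sin_div.
move=> /le_lt_trans; apply.
apply: (@le_lt_trans _ _ (2 * B)%:E); last exact: ltry.
rewrite limn_einf_lim; apply: lime_le; first exact: is_cvg_einfs.
apply: nearW => n; apply: (@le_trans _ _ (\int[P]_w (f n w)%:E)%E).
  by apply: ereal_inf_lbound; exists n => /=.
by rewrite -[leLHS]fineK ?lee_fin; [exact: fB|exact: integrable_fin_num (fi n)].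
Qed.

(** Integrability and formula advance together: the formula at order 2k makes X^(2k+2) integrable,
    |x| <= 1 + x^2 then covers order 2k+1, and these two permit two more differentiations. *)
Let gaussian_moments X : standard_gaussian X ->
  all_moments X /\ forall k, cos_moment X k.
Proof.
move=> [mX EX].
have H k : int (fun w => X w ^+ k.*2) /\ cos_moment X k.*2.
  elim: k => [|k [iX cX]].
    split=> [|t th]; first exact: (integrable_cst 1).
    under eq_Rintegral do rewrite mul1r.
    by rewrite EX mul0r subr0 /gmoment/= hornerC !mul1r.
  have iX2 := gaussian_even_step mX iX cX.
  have iX1 : int (fun w => X w ^+ k.*2.+1).
    apply: (le_integrable_fun _ _ (integrable_add iX iX2)); first exact: measurable_funX.
    move=> w; rewrite doubleS -[k.*2.+2]addn2 exprD exprSr.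
    have e : 0 <= X w ^+ k.*2 by rewrite -muln2 exprM sqr_ge0.
    rewrite normrM (ger0_norm e) [leRHS]ger0_norm; last by rewrite addr_ge0// mulr_ge0// sqr_ge0.
    rewrite -[X in _ <= X + _]mulr1 -mulrDr ler_wpM2l//.
    by rewrite -[X w ^+ 2]real_normK ?num_real//; have := sqr_ge0 (`|X w| - 1); nra.
  split=> //; rewrite doubleS; apply: cos_momentS => //.
  by apply: cos_momentS.
have iX k : int (fun w => X w ^+ k).
  have [e|o] := boolP (odd k); last first.
    by rewrite -[k]odd_double_half (negbTE o) add0n; exact: (H _).1.
  rewrite -[k]odd_double_half e add1n.
  apply: (le_integrable_fun _ _ (integrable_add (H k./2).1 (H k./2.+1).1)).
    exact: measurable_funX.
  move=> w; rewrite doubleS -[_.+2]addn2 exprD exprSr.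
  have e' : 0 <= X w ^+ (k./2).*2 by rewrite -muln2 exprM sqr_ge0.
  rewrite normrM (ger0_norm e') [leRHS]ger0_norm; last by rewrite addr_ge0// mulr_ge0// sqr_ge0.
  rewrite -[X in _ <= X + _]mulr1 -mulrDr ler_wpM2l//.
  by rewrite -[X w ^+ 2]real_normK ?num_real//; have := sqr_ge0 (`|X w| - 1); nra.
split=> //; elim=> [|k IHk]; first exact: (H 0%N).2.
exact: cos_momentS.
Qed.

Lemma gaussian_all_moments X : standard_gaussian X -> all_moments X.
Proof. by case/gaussian_moments. Qed.

Lemma gaussian_momentE X k : standard_gaussian X ->
  'E (fun w => X w ^+ k) = cos (k%:R * (pi / 2)) * (-1) ^+ k * (prob_hermite R k).[0].
Proof.
case/gaussian_moments => _ /(_ k 0 0).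
rewrite sub0r cosN /gmoment expr0n/= mulr0 expR0 mulr1 => H; rewrite -[RHS]mulrA -H.
by apply: eq_Rintegral => w _; rewrite mul0r addr0 cos0 mulr1.
Qed.

Lemma gaussian_momentSS X k : standard_gaussian X ->
  'E (fun w => X w ^+ k.+2) = k.+1%:R * 'E (fun w => X w ^+ k).
Proof.
move=> gX; rewrite !gaussian_momentE// prob_hermite0.
rewrite (_ : k.+2%:R * (pi / 2) = k%:R * (pi / 2) + pi); last first.
  by rewrite -2!natr1; field.
by rewrite cosDpi !exprS; ring.
Qed.

(** Gaussian integration by parts without a density: by linearity it reduces to monomials, where it
    is the moment recurrence [gaussian_momentSS], or E[X] = 0. *)
Lemma gaussian_stein X p : standard_gaussian X ->
  'E (fun w => X w * p.[X w]) = 'E (fun w => p^`().[X w]).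
Proof.
move=> gX; have mX := gaussian_all_moments gX.
have iH q : int (fun w => q.[X w]) by exact: all_moments_integrable (all_moments_horner q mX).
have iX q : int (fun w => X w * q.[X w]).
  by apply: all_moments_integrable; apply: all_momentsM => //; exact: all_moments_horner.
suff H k : 'E (fun w => X w * ('X^k * p).[X w]) = 'E (fun w => ('X^k * p)^`().[X w]).
  by have := H 0%N; rewrite expr0 mul1r.
elim/poly_ind: p k => [|p c IHp] k.
  by rewrite mulr0 derivC; under eq_Rintegral do rewrite horner0 mulr0;
    under [RHS]eq_Rintegral do rewrite horner0.
have -> : 'X^k * (p * 'X + c%:P) = 'X^(k.+1) * p + 'X^k * c%:P by rewrite exprSr; ring.
rewrite derivD.
transitivity ('E (fun w => X w * ('X^(k.+1) * p).[X w] + c * (X w ^+ k.+1))).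
  apply: eq_Rintegral => w _; rewrite hornerD mulrDr (mulrC 'X^k c%:P) mul_polyC hornerZ hornerXn.
  by rewrite (exprS (X w)) [X w * (c * _)]mulrCA.
rewrite RintegralD//; last by apply: integrable_scale; exact: mX.2.
rewrite IHp RintegralZl//; last exact: mX.2.
transitivity ('E (fun w => ('X^(k.+1) * p)^`().[X w] + c * ('X^k)^`().[X w])); last first.
  by apply: eq_Rintegral => w _; rewrite (mulrC 'X^k c%:P) mul_polyC derivZ hornerD hornerZ.
rewrite RintegralD//; last exact: integrable_scale.
rewrite RintegralZl//; congr (_ + c * _).
case: k => [|k].
  rewrite expr0 derivC; under [RHS]eq_Rintegral do rewrite horner0.
  by rewrite Rintegral_cst// mul0r gaussian_momentE// mul1r cos_pihalf !mul0r.
rewrite gaussian_momentSS// derivXn/= -RintegralZl//; last exact: mX.2.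
by apply: eq_Rintegral => w _; rewrite hornerMn hornerXn mulr_natl.
Qed.

(** For positive degree the recurrence He_(k+1) = x He_k - He_k' is exactly the difference that
    [gaussian_stein] annihilates. *)
Lemma gaussian_prob_hermite X k : standard_gaussian X ->
  'E (fun w => (prob_hermite R k).[X w]) = (k == 0%N)%:R.
Proof.
move=> gX; case: k => [|k].
  under eq_Rintegral do rewrite /= hornerC.
  by rewrite Rintegral_cst// mul1r; rewrite /= probability_setT.
have mX := gaussian_all_moments gX.
rewrite eqE/=.
transitivity ('E (fun w => X w * (prob_hermite R k).[X w] - (prob_hermite R k)^`().[X w])).
  by apply: eq_Rintegral => w _; rewrite hornerD hornerN hornerM hornerX.
rewrite RintegralB//.
- by rewrite gaussian_stein// subrr.
- by apply: all_moments_integrable; apply: all_momentsM => //; exact: all_moments_horner.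
- by apply: all_moments_integrable; exact: all_moments_horner.
Qed.

Lemma gaussian_mul_prob_hermite X k : standard_gaussian X ->
  'E (fun w => X w * (prob_hermite R k).[X w]) = (k == 1%N)%:R.
Proof.
move=> gX; rewrite gaussian_stein//; case: k => [|k].
  rewrite derivC; under eq_Rintegral do rewrite horner0.
  by rewrite Rintegral_cst// mul0r.
rewrite deriv_prob_hermite; under eq_Rintegral do rewrite hornerZ.
rewrite RintegralZl//; last first.
  by apply: all_moments_integrable; apply: all_moments_horner; exact: gaussian_all_moments.
by rewrite gaussian_prob_hermite// eqSS; case: eqP => [->|_]; rewrite ?mulr1 ?mulr0.
Qed.

(** The assumption says that Y - c is orthogonal to every cos(t X + th), so [moment_eq0] applies to
    it. This is the form in which independence is used. *)
Lemma gaussian_decouple X Y (c : R) p : standard_gaussian X -> all_moments Y ->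
  (forall t th, 'E (fun w => Y w * cos (t * X w + th)) =
                c * (cos th * expR (- 2^-1 * t ^+ 2))) ->
  'E (fun w => Y w * p.[X w]) = c * 'E (fun w => p.[X w]).
Proof.
move=> gX mY EY; have mX := gaussian_all_moments gX.
have ip : int (fun w => p.[X w]) by exact: all_moments_integrable (all_moments_horner p mX).
have iYp : int (fun w => Y w * p.[X w]).
  by apply: all_moments_integrable; apply: all_momentsM => //; exact: all_moments_horner.
apply/eqP; rewrite -subr_eq0 -RintegralZl// -RintegralB//; last exact: integrable_scale.
rewrite -(@moment_eq0 X (fun w => Y w - c) p mX.1); first by apply/eqP/eq_Rintegral => w _; ring.
  move=> k; apply: all_moments_integrable; apply: all_momentsM.
    by apply: all_momentsD => //; exact: (all_moments_cst (- c)).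
  by have := all_moments_horner 'X^k mX; under eq_fun do rewrite hornerXn.
move=> t th.
have ic : int (fun w => cos (t * X w + th)).
  exact: all_moments_integrable (all_moments_cos _ _ mX.1).
under eq_Rintegral do rewrite mulrBl.
rewrite RintegralB//; last exact: integrable_scale.
  by rewrite EY RintegralZl// gX.2 subrr.
by apply: integrable_mul_cos mX.1 _; exact: all_moments_integrable.
Qed.

End Probability.

(** * White noise *)

Section Lebesgue2.
Context d (T : measurableType d) (R : realType) (P : probability T R).
Implicit Types (X Y : T -> R).
Local Notation int f := (P.-integrable setT (EFin \o f)).
Local Notation "''E' f" := (\int[P]_w f w) (at level 10, f at level 8).

Lemma Lfun_measurable X p : X \in Lfun P p -> measurable_fun setT X.
Proof. by rewrite inE => /andP[/[!inE]]. Qed.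

Lemma Lfun2_norm_lty X : X \in Lfun P 2%:E -> ('N[P]_2%:E[EFin \o X] < +oo)%E.
Proof. by rewrite inE => /andP[_ /[!inE]]. Qed.

Lemma Lfun2_norm_fine X : X \in Lfun P 2%:E ->
  'N[P]_2%:E[EFin \o X]%E = (fine 'N[P]_2%:E[EFin \o X]%E)%:E.
Proof. by move=> /Lfun2_norm_lty h; rewrite fineK// ge0_fin_numE// Lnorm_ge0. Qed.

Lemma all_moments_Lfun2 X : all_moments P X -> X \in Lfun P 2%:E.
Proof.
move=> [mX /(_ 2%N) /integrableP[_ iX]]; rewrite inE; apply/andP; split.
  by rewrite inE.
rewrite inE /finite_norm unlock; apply: poweR_lty; apply: le_lt_trans iX.
rewrite le_eqVlt; apply/orP; left; apply/eqP; apply: eq_integral => w _.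
by rewrite /= powR_mulrn// normrX.
Qed.

Lemma ae_eq_Lnorm2 X Y : measurable_fun setT X -> measurable_fun setT Y ->
  X = Y %[ae P] -> 'N[P]_2%:E[EFin \o X]%E = 'N[P]_2%:E[EFin \o Y]%E.
Proof.
move=> mX mY XY; rewrite unlock; congr (_ `^ _)%E.
have m (Z : T -> R) : measurable_fun setT Z ->
    measurable_fun setT (fun x => `|(EFin \o Z) x| `^ 2%R)%E.
  move=> mZ.
  apply: (measurableT_comp (measurable_poweR _)).
  by apply: measurableT_comp => //; exact/measurable_EFinP.
apply: ae_eq_integral => //; [exact: m|exact: m|].
by apply: filterS XY => w /= h _; rewrite h.
Qed.

Lemma ae_eq_Rintegral X Y : measurable_fun setT X -> measurable_fun setT Y ->
  X = Y %[ae P] -> 'E X = 'E Y.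
Proof.
move=> mX mY XY; congr fine; apply: ae_eq_integral => //; try exact/measurable_EFinP.
by apply: filterS XY => w /= h _; rewrite h.
Qed.

Lemma Lfun2_mul_integrable X Y : X \in Lfun P 2%:E -> Y \in Lfun P 2%:E ->
  int (fun w => X w * Y w).
Proof. by move=> hX hY; apply/Lfun1_integrable; exact: Lfun2_mul_Lfun1. Qed.

Lemma cauchy_schwarz X Y : X \in Lfun P 2%:E -> Y \in Lfun P 2%:E ->
  'E (fun w => `|X w * Y w|) <=
  fine 'N[P]_2%:E[EFin \o X]%E * fine 'N[P]_2%:E[EFin \o Y]%E.
Proof.
move=> hX hY.
have := @hoelder _ _ _ P X Y 2 2 (Lfun_measurable hX) (Lfun_measurable hY).
rewrite !ltr0n => /(_ isT isT); rewrite -[X in _ = X -> _]/(1:R) => /(_ _)/le_trans H.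
have iXY : int (fun w => `|X w * Y w|) by apply: integrable_norm; exact: Lfun2_mul_integrable.
rewrite -lee_fin EFinM -!Lfun2_norm_fine// /Rintegral fineK; last exact: integrable_fin_num iXY.
have E1 : (\int[P]_w `|X w * Y w|%:E = 'N[P]_1[EFin \o (X \* Y)%R])%E by rewrite Lnorm1.
by rewrite E1; apply: H; first by field.
Qed.

Lemma Lfun2_cst (c : R) : (fun _ : T => c) \in Lfun P 2%:E.
Proof. by apply: all_moments_Lfun2; exact: all_moments_cst. Qed.

Lemma Lnorm2_1 : 'N[P]_2%:E[EFin \o (fun _ : T => 1%R)]%E = 1%E.
Proof.
rewrite [LHS](@Lnorm_cst1 _ _ _ P 2) -[RHS](poweR1r 2^-1).
by congr (_ `^ _)%E; exact: probability_setT.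
Qed.

End Lebesgue2.

(** * The characteristic functional on the Hilbert space and joint moments of the basis variables *)

Section WhiteNoise.
Context (R : realType) (sigma : {measure set (measurableTypeR R) -> \bar R}).
Context (P : probability (white_space R) R) (H : hilbert_completion sigma).
Context (Q : H -> white_space R -> R).
Hypotheses (P_sigma : white_noise_measure sigma P) (Q_ext : isometric_extension P Q).
Local Notation "''E' f" := (\int[P]_w f w) (at level 10, f at level 8).

Lemma pairing_measurable (s : schwartz_space R) :
  measurable_fun setT (fun w : white_space R => (w : tempered R) s).
Proof.
move=> _ A mA; rewrite setTI; apply: sub_sigma_algebra.
by exists s, A.
Qed.

Lemma spectral_dotE (s : schwartz_space R) :
  \int[sigma]_u Normc.normc (fourier s u) ^+ 2 = `|hc_inj H s| ^+ 2.
Proof.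
rewrite hc_normE hc_dotE /spectral_dot /cintegral /=; apply: eq_Rintegral => u _.
case: (fourier s u) => a b /=; rewrite sqr_sqrtr ?addr_ge0 ?sqr_ge0//.
by rewrite mulNr opprK !expr2.
Qed.

(** The left side of the defining identity is real, so the sine integral vanishes; the addition
    formula then brings in the phase. *)
Lemma characteristic_schwartz (s : schwartz_space R) (th : R) :
  'E (fun w => cos ((w : tempered R) s + th)) =
  cos th * expR (- 2^-1 * `|hc_inj H s| ^+ 2).
Proof.
have := P_sigma s; rewrite spectral_dotE /cintegral => -[Ere Eim].
have ms := pairing_measurable s.
have ic t : P.-integrable setT (EFin \o (fun w : white_space R => cos ((w : tempered R) s + t))).
  have := all_moments_integrable (all_moments_cos P 1 t ms).
  by under eq_fun do rewrite mul1r.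
have is_ : P.-integrable setT (EFin \o (fun w : white_space R => sin ((w : tempered R) s))).
  have := integrable_scale (-1) (ic (pi / 2)).
  by under eq_fun do rewrite cosDpihalf mulN1r opprK.
have ic0 : P.-integrable setT (EFin \o (fun w : white_space R => cos ((w : tempered R) s))).
  by have := ic 0; under eq_fun do rewrite addr0.
under eq_Rintegral do rewrite cosD mulrC [X in _ - X]mulrC.
rewrite RintegralB//; try exact: integrable_scale.
rewrite !RintegralZl// -mulNr; rewrite -Ere.
rewrite (_ : \int[P]_x sin _ = 0); last by rewrite [RHS]Eim.
by rewrite mulr0 addr0 mulNr.
Qed.

Lemma Q_Lfun2 v : Q v \in Lfun P 2%:E. Proof. by case: Q_ext. Qed.

Lemma Q_measurable v : measurable_fun setT (Q v).
Proof. exact: Lfun_measurable (Q_Lfun2 v). Qed.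

Lemma Q_linear (a : R) (u v : H) : Q (a *: u + v) = a *: Q u + Q v %[ae P].
Proof. by case: Q_ext. Qed.

Lemma Q_norm v : 'N[P]_2%:E[EFin \o Q v]%E = `|v|%:E.
Proof. by case: Q_ext. Qed.

Lemma Q_sub (u v : H) : Q (u - v) = (fun w => Q u w - Q v w) %[ae P].
Proof.
have := Q_linear (-1) v u; apply: filterS => w /= h _.
by rewrite addrC -scaleN1r h// -[_ w]/(-1 * Q v w + Q u w) mulN1r addrC.
Qed.

Lemma Q_zero : Q 0 = (fun=> 0) %[ae P].
Proof. by apply: filterS (Q_sub 0 0) => w h _; rewrite -[in LHS](subrr 0) h// subrr. Qed.

Lemma Q_affine (t : R) (u v : H) :
  Q (v + t *: u) = (fun w => Q v w + t * Q u w) %[ae P].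
Proof.
by apply: filterS (Q_linear t u v) => w h _; rewrite addrC h// addrC.
Qed.

Lemma Q_sum (c : nat -> R) (u : nat -> H) m :
  Q (\sum_(n < m) c n *: u n) = (fun w => \sum_(n < m) c n * Q (u n) w) %[ae P].
Proof.
elim: m => [|m IHm].
  by rewrite big_ord0; apply: filterS Q_zero => w h _; rewrite h// big_ord0.
rewrite big_ord_recr/=;
  apply: filterS2 IHm (Q_affine (c m) (u m) (\sum_(n < m) c n *: u n)) => w h1 h2 _.
by rewrite h2// h1// big_ord_recr.
Qed.

(** Cauchy-Schwarz and the isometry; it lets expansion coefficients pass to the limit. *)
Lemma dist_integral_le u v Y : Y \in Lfun P 2%:E ->
  `|'E (fun w => Q u w * Y w) - 'E (fun w => Q v w * Y w)| <=
  `|u - v| * fine 'N[P]_2%:E[EFin \o Y]%E.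
Proof.
move=> hY; have i z := Lfun2_mul_integrable (Q_Lfun2 z) hY.
have mY := Lfun_measurable hY.
rewrite -RintegralB//.
rewrite (@ae_eq_Rintegral _ _ _ _ _ (fun w => Q (u - v) w * Y w)).
- rewrite (le_trans (le_normr_Rintegral measurableT (i _)))//.
  by rewrite (le_trans (cauchy_schwarz (Q_Lfun2 _) hY))// Q_norm.
- by apply: measurable_funB; apply: measurable_funM => //; exact: Q_measurable.
- by apply: measurable_funM => //; exact: Q_measurable.
- by apply: filterS (Q_sub u v) => w h _; rewrite h// mulrBl.
Qed.

Lemma integral_dist_le u v : 'E (fun w => `|Q u w - Q v w|) <= `|u - v|.
Proof.
have m1 : measurable_fun setT (fun w => `|Q u w - Q v w|).
  by apply: measurableT_comp => //; apply: measurable_funB; exact: Q_measurable.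
rewrite (@ae_eq_Rintegral _ _ _ _ _ (fun w => `|Q (u - v) w * 1|))//.
- rewrite (le_trans (cauchy_schwarz (Q_Lfun2 _) (Lfun2_cst _ _)))//.
  by rewrite Q_norm Lnorm2_1 mulr1.
- apply: measurableT_comp => //; apply: measurable_funM => //; exact: Q_measurable.
- by apply: filterS (Q_sub u v) => w h _; rewrite h// mulr1.
Qed.

(** Both sides are continuous in v, the left one being 1-Lipschitz since cosine is and E|Q u - Q v|
    <= |u - v|. They agree on the image of the Schwartz functions, so the open set where they differ
    cannot meet that dense range. *)
Lemma characteristic (v : H) (th : R) :
  'E (fun w => cos (Q v w + th)) = cos th * expR (- 2^-1 * `|v| ^+ 2).
Proof.
have mc u : measurable_fun setT (fun w => cos (Q u w + th)).
  have := measurable_cos_comp 1 th (Q_measurable u).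
  by under eq_fun do rewrite mul1r.
have ic u : P.-integrable setT (EFin \o (fun w => cos (Q u w + th))).
  have := all_moments_integrable (all_moments_cos P 1 th (Q_measurable u)).
  by under eq_fun do rewrite mul1r.
pose f (v : H) := 'E (fun w => cos (Q v w + th)).
pose g (v : H) := cos th * expR (- 2^-1 * `|v| ^+ 2).
have fs s : f (hc_inj H s) = g (hc_inj H s).
  rewrite /g -characteristic_schwartz; apply: ae_eq_Rintegral => //.
    have := measurable_cos_comp 1 th (pairing_measurable s).
    by under eq_fun do rewrite mul1r.
  by have [_ _ _ /(_ s)] := Q_ext; apply: filterS => w h _; rewrite h.
have flip u z : `|f u - f z| <= `|u - z|.
  rewrite /f -RintegralB//; apply: (le_trans (le_normr_Rintegral measurableT _)).
    exact: (integrable_sub (ic u) (ic z)).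
  apply: le_trans (integral_dist_le u z); apply: le_Rintegral => //.
  - by apply: integrable_norm; exact: (integrable_sub (ic u) (ic z)).
  - apply: integrable_norm; apply: integrable_sub; apply/Lfun1_integrable;
      by apply: (Lfun_subset12 (fin_num_measure P _ measurableT)); exact: Q_Lfun2.
  - by move=> w _; rewrite (le_trans (dist_cos_le _ _))// opprD addrACA subrr addr0.
have cf : continuous f.
  move=> u; apply/cvgrPdist_lt => e e0; near=> z.
  by apply: le_lt_trans (flip _ _) _; near: z; exact: cvgr_dist_lt.
have cg : continuous g.
  have cn : continuous (fun v : H => - 2^-1 * (`|v| * `|v|)).
    by move=> u; apply: cvgMr; apply: cvgM; exact: norm_continuous.
  have ce : continuous (fun v : H => expR (- 2^-1 * (`|v| * `|v|))).
    by move=> u; exact: (continuous_comp (cn u) (@continuous_expR _ _)).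
  by move=> u; apply: cvgMr; exact: ce.
have cfg : continuous (fun v => f v - g v).
  by move=> u; apply: cvgB; [exact: cf|exact: cg].
apply/eqP; rewrite -subr_eq0; apply/eqP/eqP; rewrite -[_ == 0]negbK; apply/negP => vn0.
have O1 : open ((fun v => f v - g v) @^-1` [set x | x != 0]).
  by apply: open_comp; [move=> x _; exact: cfg|exact: open_neq].
have [x [/= xn0 [s _ sx]]] := @hc_dense _ _ H _ (ex_intro _ v vn0) O1.
by move: xn0; rewrite -sx fs subrr eqxx.
Unshelve. all: by end_near. Qed.

Context (g : nat -> H).
Hypothesis g_orth : forall i j, hc_dot H (g i) (g j) = (i == j)%:R.
Local Notation Z n := (Q (g n)).

Lemma hc_norm_orth (u v : H) : hc_dot H u v = 0 ->
  `|u + v| ^+ 2 = `|u| ^+ 2 + `|v| ^+ 2.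
Proof. by move=> uv; rewrite !hc_normE hnormDd. Qed.

Lemma hc_norm_basis n : `|g n| = 1.
Proof.
apply/eqP; rewrite -(@eqrXn2 _ 2)//; apply/eqP.
by rewrite hc_normE g_orth eqxx expr1n.
Qed.

Lemma basis_gaussian n : standard_gaussian P (Z n).
Proof.
split=> [|t th]; first exact: Q_measurable.
have -> : - 2^-1 * t ^+ 2 = - 2^-1 * `|0 + t *: g n| ^+ 2.
  by rewrite add0r normrZ hc_norm_basis mulr1 real_normK ?num_real.
rewrite -characteristic.
apply: ae_eq_Rintegral.
- exact: measurable_cos_comp (Q_measurable _).
- have := measurable_cos_comp 1 th (Q_measurable (0 + t *: g n)).
  by under eq_fun do rewrite mul1r.
- apply: filterS2 Q_zero (Q_affine t (g n) 0) => w h0 h _.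
  by rewrite h// h0// add0r.
Qed.

Lemma basis_all_moments n : all_moments P (Z n).
Proof. exact: gaussian_all_moments (basis_gaussian n). Qed.

(* Joint independence of the Z_n. The factor cos (Q v + th) makes the induction on J
   work: product-to-sum formulas absorb t Z_j into v. *)
Lemma basis_product (J : seq nat) (p : nat -> {poly R}) : uniq J ->
  forall (v : H) (th : R), (forall j, j \in J -> hc_dot H v (g j) = 0) ->
  'E (fun w => cos (Q v w + th) * \prod_(j <- J) (p j).[Z j w]) =
  cos th * expR (- 2^-1 * `|v| ^+ 2) * \prod_(j <- J) 'E (fun w => (p j).[Z j w]).
Proof.
elim: J => [_ v th _|j J IHJ /= /andP[jJ uJ] v th vJ].
  rewrite big_nil mulr1 -characteristic.
  by apply: eq_Rintegral => w _; rewrite big_nil mulr1.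
have aprod : all_moments P (fun w => \prod_(i <- J) (p i).[Z i w]).
  by apply: all_moments_prod => i; apply: all_moments_horner; exact: basis_all_moments.
have acos u t : all_moments P (fun w => cos (Q u w + t)).
  by have := all_moments_cos P 1 t (Q_measurable u); under eq_fun do rewrite mul1r.
have aY u t : all_moments P (fun w => cos (Q u w + t) * \prod_(i <- J) (p i).[Z i w]).
  exact: all_momentsM.
rewrite big_cons mulrCA.
rewrite [RHS]mulrC -(gaussian_decouple (p j) (basis_gaussian j) (aY v th)).
  by apply: eq_Rintegral => w _; rewrite big_cons; ring.
move=> t th'.
have vj u s : hc_dot H (v + s *: g j) (g u) = (s * (j == u)%:R + hc_dot H v (g u)).
  by rewrite linearDl/= linearZl_LR/= g_orth addrC.
have orth s : forall i, i \in J -> hc_dot H (v + s *: g j) (g i) = 0.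
  move=> i iJ; rewrite vj vJ ?in_cons ?iJ ?orbT// addr0.
  by case: eqP => [ji|_]; [move: jJ; rewrite ji iJ|rewrite mulr0].
have nrm s : `|v + s *: g j| ^+ 2 = `|v| ^+ 2 + s ^+ 2.
  rewrite hc_norm_orth.
    by rewrite normrZ hc_norm_basis mulr1 real_normK ?num_real.
  by rewrite linearZr_LR/= vJ ?mem_head// mulr0.
have E1 s ph : 'E (fun w => cos (Q v w + s * Z j w + ph) * \prod_(i <- J) (p i).[Z i w]) =
    cos ph * (expR (- 2^-1 * `|v| ^+ 2) * expR (- 2^-1 * s ^+ 2)) *
    \prod_(i <- J) 'E (fun w => (p i).[Z i w]).
  rewrite -expRD -mulrDr -nrm -IHJ//; last exact: orth.
  apply: ae_eq_Rintegral.
  - apply: measurable_funM; last exact: aprod.1.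
    apply: (measurableT_comp (f := cos)).
      by apply: continuous_measurable_fun; exact: continuous_cos.
    do 2 apply: measurable_funD => //; first exact: Q_measurable.
    by apply: measurable_funM => //; exact: Q_measurable.
  - exact: (aY _ _).1.
  - by apply: filterS (Q_affine s (g j) v) => w h _; rewrite h.
(* Product-to-sum yields the vectors v + t g_j and v - t g_j, both still orthogonal to the rest of J
   and of squared norm |v|^2 + t^2. The factor e^(-t^2/2) is common, and the two phases recombine to
   cos th cos th'. *)
rewrite (_ : \int[P]_w _ = 2^-1 * (
   'E (fun w => cos (Q v w + t * Z j w + (th + th')) * \prod_(i <- J) (p i).[Z i w]) +
   'E (fun w => cos (Q v w + (- t) * Z j w + (th - th')) * \prod_(i <- J) (p i).[Z i w]))).
  by rewrite !E1 sqrrN cosD cosB; field.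
have iY s ph : P.-integrable setT (EFin \o (fun w =>
    cos (Q v w + s * Z j w + ph) * \prod_(i <- J) (p i).[Z i w])).
  apply: all_moments_integrable; apply: all_momentsM => //.
  apply: (@all_moments_bounded _ _ _ _ _ 1) => [|w]; last exact: cos_max.
  apply: (measurableT_comp (f := cos)).
    by apply: continuous_measurable_fun; exact: continuous_cos.
  do 2 apply: measurable_funD => //; first exact: Q_measurable.
  by apply: measurable_funM => //; exact: Q_measurable.
rewrite -RintegralD// -RintegralZl//; last exact: integrable_add.
apply: eq_Rintegral => w _; rewrite mulrAC cosM -mulrDl mulrA.
by congr (_ * (cos _ + cos _) * _); ring.
Qed.

End WhiteNoise.

Definition eps (n : nat) : multiindex := [fsfun [fsfun] with n |-> 1%N].

Lemma epsE n m : eps n m = (m == n).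
Proof. by rewrite fsfun_withE; case: eqP => // _; rewrite fsfun0E. Qed.

Lemma finsupp_eps n : finsupp (eps n) = [fset n]%fset.
Proof.
apply/fsetP => m; by rewrite mem_finsupp inE epsE eqb0 negbK.
Qed.

Lemma eps_inj : injective eps.
Proof.
move=> n m nm; apply/eqP; have := epsE n n; rewrite nm epsE eqxx.
by case: eqP.
Qed.

Lemma multi_fact_eps n : multi_fact (eps n) = 1%N.
Proof. by rewrite /multi_fact finsupp_eps big_seq_fset1 epsE eqxx. Qed.

Lemma two_N_eps (R : realType) n : two_N R (eps n) = (2 * n.+1)%:R.
Proof. by rewrite /two_N finsupp_eps big_seq_fset1 epsE eqxx expr1. Qed.

(** * Pairing the basis variables with the Hermite products *)

Section WickBasis.
Context (R : realType) (sigma : {measure set (measurableTypeR R) -> \bar R}).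
Context (P : probability (white_space R) R) (H : hilbert_completion sigma).
Context (Q : H -> white_space R -> R).
Hypotheses (P_sigma : white_noise_measure sigma P) (Q_ext : isometric_extension P Q).
Context (g : nat -> H).
Hypothesis g_orth : forall i j, hc_dot H (g i) (g j) = (i == j)%:R.
Local Notation "''E' f" := (\int[P]_w f w) (at level 10, f at level 8).
Let Z n := Q (g n).

Lemma wick_basis_moments alpha : all_moments P (wick_basis Z alpha).
Proof.
apply: all_moments_prod => n; apply: all_moments_horner.
exact: (basis_all_moments P_sigma Q_ext g_orth).
Qed.

Lemma wick_basis_Lfun2 alpha : wick_basis Z alpha \in Lfun P 2%:E.
Proof. exact/all_moments_Lfun2/wick_basis_moments. Qed.

(** Z_n is merged into the factor of index n, where x He_a integrates to 1 if a = 1 and to 0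
    otherwise; at other indices He_a integrates to 1 if a = 0 and to 0 otherwise. [basis_product] is
    used with v = 0 and phase 0, its cosine being 1 almost surely. *)
Lemma integral_basis_wick n alpha :
  'E (fun w => Z n w * wick_basis Z alpha w) = (alpha == eps n)%:R.
Proof.
pose J := (n |` finsupp alpha)%fset.
pose p m : {poly R} := (if m == n then 'X else 1) * prob_hermite R (alpha m).
have gZ m := basis_gaussian P_sigma Q_ext g_orth m.
have pE m : 'E (fun w => (p m).[Z m w]) = (alpha m == eps n m)%:R.
  rewrite epsE /p; case: eqP => [->|_].
    rewrite -(gaussian_mul_prob_hermite _ (gZ n)).
    by apply: eq_Rintegral => w _; rewrite hornerM hornerX.
  rewrite mul1r; exact: gaussian_prob_hermite (gZ m).
transitivity ('E (fun w => cos (Q 0 w + 0) * \prod_(m <- J) (p m).[Z m w])); last first.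
  rewrite (basis_product P_sigma Q_ext g_orth p (fset_uniq J)); last first.
    by move=> j _; rewrite linear0l.
  rewrite cos0 normr0 expr0n/= mulr0 expR0 !mul1r.
  under eq_bigr do rewrite pE.
  have [->|an] := eqVneq alpha (eps n); first by rewrite big1// => m _; rewrite eqxx.
  (* Outside J both alpha and [eps n] vanish, so a differing index produces a zero factor. *)
  have [m mJ am] : exists2 m, m \in J & alpha m != eps n m.
    apply: contrapT => h; move/eqP: an; apply; apply/fsfunP => m.
    apply: contrapT => /eqP am; apply: h; exists m => //.
    rewrite in_fset1U mem_finsupp; apply: contraNT am.
    by rewrite negb_or negbK => /andP[mn /eqP ->]; rewrite epsE (negbTE mn).
  by rewrite (big_fsetD1 m)//= (negbTE am) mul0r.
apply: ae_eq_Rintegral.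
- by apply: measurable_funM; [exact: Q_measurable Q_ext _|exact: (wick_basis_moments alpha).1].
- apply: measurable_funM; first have := measurable_cos_comp 1 0 (Q_measurable Q_ext 0).
    by under eq_fun do rewrite mul1r.
  apply: (all_moments_prod (P := P) _ _).1 => m; apply: all_moments_horner.
  exact: (basis_all_moments P_sigma Q_ext g_orth).
- apply: filterS (Q_zero Q_ext) => w h _; rewrite h// addr0 cos0 mul1r /wick_basis.
  rewrite [RHS](big_fsetD1 n) ?fset1U1//= /p eqxx hornerM hornerX -mulrA; congr (_ * _).
  rewrite [in RHS](eq_big_seq (fun m => (prob_hermite R (alpha m)).[Z m w])); last first.
    by move=> m; rewrite !inE => /andP[/negbTE -> _]; rewrite mul1r.
  have [na|na] := boolP (n \in finsupp alpha).
    rewrite (big_fsetD1 n)//=; congr (_ * _); congr (\prod_(i <- _) _).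
    by congr enum_fset; apply/fsetP => m; rewrite !inE; case: eqP.
  move: (na); rewrite memNfinsupp => /eqP ->; rewrite hornerC mul1r.
  congr (\prod_(i <- _) _); congr enum_fset; apply/fsetP => m; rewrite !inE.
  by case: eqP => // ->; rewrite (negbTE na).
Qed.

Lemma integral_partial_sum_wick (c : nat -> R) m alpha :
  'E (fun w => Q (\sum_(n < m) c n *: g n) w * wick_basis Z alpha w) =
  \sum_(n < m) c n * (alpha == eps n)%:R.
Proof.
have hY := wick_basis_Lfun2 alpha.
have mY := (wick_basis_moments alpha).1.
have i u := Lfun2_mul_integrable (Q_Lfun2 Q_ext u) hY.
have mQ u : measurable_fun setT (fun w => Q u w * wick_basis Z alpha w).
  exact: integrable_measurable (i u).
elim: m => [|m IHm].
  rewrite !big_ord0 (@ae_eq_Rintegral _ _ _ _ _ (fun=> 0))//.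
    by rewrite Rintegral_cst// mul0r.
  by apply: filterS (Q_zero Q_ext) => w h _; rewrite h// mul0r.
rewrite !big_ord_recr/= -IHm -(integral_basis_wick m) -RintegralZl; [|by []|exact: i].
rewrite -RintegralD; [|by []|exact: i|exact: (integrable_scale _ (i _))].
apply: ae_eq_Rintegral => //.
  by apply: measurable_funD; [exact: mQ|apply: measurable_funM => //; exact: mQ].
apply: filterS (Q_affine Q_ext (c m) (g m) (\sum_(n < m) c n *: g n)) => w h _.
by rewrite h// mulrDl mulrA.
Qed.

End WickBasis.

(** * The first chaos in the Kondratiev space *)

Section FirstChaos.
Variable R : realType.
Implicit Types (b c : nat -> R).

(** Comparison with 1 plus the integral of x^(-3/2) from 1 on; the induction carries the sharper
    bound 3 - 2/sqrt N for N >= 1 terms. *)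
Lemma sum_inv_sqrt_cube_le N : \sum_(n < N) (Num.sqrt n.+1%:R ^+ 3)^-1 <= 3 :> R.
Proof.
have p1 m : 0 < Num.sqrt m.+1%:R :> R by rewrite sqrtr_gt0.
have p2 m : Num.sqrt m.+1%:R ^+ 2 = m.+1%:R :> R by rewrite sqr_sqrtr.
case: N => [|N]; first by rewrite big_ord0.
apply: (@le_trans _ _ (3 - 2 / Num.sqrt N.+1%:R)); last first.
  by rewrite gerBl divr_ge0// ltW.
elim: N => [|N IHN].
  by rewrite big_ord_recl big_ord0 sqrtr1 expr1n; lra.
rewrite big_ord_recr/= (le_trans (lerD IHN (lexx _)))//.
set x := Num.sqrt N.+1%:R; set y := Num.sqrt N.+2%:R.
have x0 : 0 < x by exact: p1.
have y0 : 0 < y by exact: p1.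
have xy : y ^+ 2 = x ^+ 2 + 1 by rewrite /x /y !p2 natr1.
have lexy : x <= y by rewrite /x /y ler_wsqrtr// ler_nat.
rewrite -addrA lerD2l -lerBrDr -opprB opprK.
rewrite -subr_ge0.
(* y^2 - x^2 stays symbolic so that [field] proves the identity; once it is replaced by 1, the claim
   is 2 y^2 >= x (x + y), true for x <= y. *)
rewrite [leRHS](_ : _ =
  ((y ^+ 2 - x ^+ 2) * (2 * y ^+ 2 - x * (x + y)) +
   (x * (x + y)) * ((y ^+ 2 - x ^+ 2) - 1)) / (x * (x + y) * y ^+ 3)); last first.
  by field; rewrite !lt0r_neq0// addr_gt0.
apply: divr_ge0; last by rewrite !mulr_ge0 ?addr_ge0 ?exprn_ge0// ltW.
have -> : y ^+ 2 - x ^+ 2 = 1 by rewrite xy addrC addKr.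
rewrite subrr mulr0 addr0 mul1r subr_ge0 mulrDr; nra.
Qed.

(** As alpha = [eps n] forces n into the support, the finite sum gives b_n at [eps n] and 0
    elsewhere, and is visibly linear in b. *)
Definition chaos_coef b : multiindex -> R :=
  fun alpha => \sum_(n <- finsupp alpha) b n * (alpha == eps n)%:R.

Lemma chaos_coef_eps b n : chaos_coef b (eps n) = b n.
Proof. by rewrite /chaos_coef finsupp_eps big_seq_fset1 eqxx mulr1. Qed.

Lemma chaos_coef_out b alpha : (forall n, alpha != eps n) -> chaos_coef b alpha = 0.
Proof. by move=> h; rewrite /chaos_coef big1// => n _; rewrite (negbTE (h n)) mulr0. Qed.

Lemma chaos_coef_lin (a : R) b c : chaos_coef (fun n => a * b n + c n) =
  a *: chaos_coef b + chaos_coef c.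
Proof.
apply/funext => alpha; rewrite -[RHS]/(a * chaos_coef b alpha + chaos_coef c alpha).
rewrite /chaos_coef mulr_sumr -big_split/=; apply: eq_bigr => n _.
by rewrite mulrDl mulrA.
Qed.

Lemma kond_sqnorm_chaos_le k b (C : R) : 0 <= C ->
  (forall n, b n ^+ 2 / (2 * n.+1)%:R ^+ k <= C / Num.sqrt n.+1%:R ^+ 3) ->
  (kond_sqnorm k (chaos_coef b) <= (3 * C)%:E)%E.
Proof.
move=> C0 bC; rewrite /kond_sqnorm.
rewrite (eq_esum (b := fun alpha => if alpha \in range eps
    then (chaos_coef b alpha ^+ 2 / two_N R alpha ^+ k)%:E else 0%E)); last first.
  move=> alpha _; case: ifPn => // /negP h; rewrite chaos_coef_out ?expr0n ?mul0r//.
  by move=> n; apply/eqP => an; apply: h; rewrite inE; exists n.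
rewrite -esum_mkcond esum_image; last by move=> x y _ _; exact: eps_inj.
rewrite (eq_esum (b := fun n => (b n ^+ 2 / (2 * n.+1)%:R ^+ k)%:E)); last first.
  by move=> n _; rewrite chaos_coef_eps two_N_eps.
have t0 n : (0 <= (b n ^+ 2 / (2 * n.+1)%:R ^+ k)%:E)%E.
  by rewrite lee_fin divr_ge0 ?sqr_ge0// exprn_ge0.
rewrite -nneseries_esumT//; apply: lime_le; first exact: is_cvg_nneseries.
apply: nearW => N; rewrite sumEFin lee_fin big_mkord.
apply: (@le_trans _ _ (\sum_(n < N) C / Num.sqrt n.+1%:R ^+ 3)); first exact: ler_sum.
by rewrite -mulr_sumr mulrC ler_wpM2r// sum_inv_sqrt_cube_le.
Qed.

(* The weight (2(n+1))^-2 turns a growth of order sqrt(n+1) into (n+1)^(-3/2)/4. *)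
Lemma chaos_weight_le b (C : R) n : 0 <= C -> b n ^+ 2 <= C * Num.sqrt n.+1%:R ->
  b n ^+ 2 / (2 * n.+1)%:R ^+ 2 <= (C / 4) / Num.sqrt n.+1%:R ^+ 3.
Proof.
move=> C0 bC; set s := Num.sqrt n.+1%:R in bC *.
have s0 : 0 < s by rewrite sqrtr_gt0.
have sE : n.+1%:R = s ^+ 2 by rewrite sqr_sqrtr.
rewrite natrM sE ler_pdivrMr ?exprn_gt0 ?mulr_gt0 ?exprn_gt0//.
rewrite (_ : _ / 4 / _ * _ = C * s)//; field; exact: lt0r_neq0.
Qed.

Lemma kond_sqnorm2_chaos_le b (C : R) : 0 <= C ->
  (forall n, b n ^+ 2 <= C * Num.sqrt n.+1%:R) ->
  (kond_sqnorm 2 (chaos_coef b) <= C%:E)%E.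
Proof.
move=> C0 bC; have C4 : 0 <= C / 4 by rewrite divr_ge0.
apply: le_trans (kond_sqnorm_chaos_le C4 (fun n => chaos_weight_le C0 (bC n))) _.
by rewrite lee_fin; lra.
Qed.

(** Compared with H_2, the additional weight 1/(2(n+1)) is at most 1/(m+1) where b is nonzero, which
    turns the uniform bound into a rate. *)
Lemma kond_sqnorm3_chaos_tail_le b (C : R) m : 0 <= C ->
  (forall n, b n ^+ 2 <= C * Num.sqrt n.+1%:R) ->
  (forall n, (n < m)%N -> b n = 0) ->
  (kond_sqnorm 3 (chaos_coef b) <= (C / m.+1%:R)%:E)%E.
Proof.
move=> C0 bC b0; have C4 : 0 <= C / m.+1%:R / 4 by rewrite !divr_ge0.
apply: le_trans (kond_sqnorm_chaos_le C4 _) _; last first.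
  by rewrite lee_fin; move: (C / _) (divr_ge0 C0 (ler0n R m.+1)) => t; lra.
move=> n; have [nm|mn] := ltnP n m.
  by rewrite b0// expr0n mul0r divr_ge0// exprn_ge0// sqrtr_ge0.
rewrite [(2 * n.+1)%:R ^+ 3]exprSr invfM mulrA.
have w0 : 0 <= (2 * n.+1)%:R^-1 :> R by rewrite invr_ge0.
apply: (le_trans (ler_wpM2r w0 (chaos_weight_le C0 (bC n)))).
rewrite [C / m.+1%:R / 4]mulrAC [leRHS]mulrAC ler_wpM2l//.
  by rewrite !divr_ge0// exprn_ge0// sqrtr_ge0.
by rewrite lef_pV2 ?posrE// ler_nat (@leq_trans n.+1)// leq_pmull.
Qed.

(* Junk value 0 if the formal series of the b_n H_(eps n) is not in K'. *)
Definition chaos b : kondratiev R := insubd 0 (chaos_coef b).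

Definition moderate b := exists2 C : R, 0 <= C & forall n, b n ^+ 2 <= C * Num.sqrt n.+1%:R.

Lemma chaosE b : moderate b -> kond_coef (chaos b) = chaos_coef b.
Proof.
move=> [C C0 bC]; rewrite /chaos val_insubd; case: ifPn => // /negP[].
rewrite unfold_in; apply/asboolP; exists 2%N.
exact: le_lt_trans (kond_sqnorm2_chaos_le C0 bC) (ltry _).
Qed.

Lemma chaos_lin (a : R) b c : moderate b -> moderate c ->
  moderate (fun n => a * b n + c n) ->
  chaos (fun n => a * b n + c n) = a *: chaos b + chaos c.
Proof.
by move=> mb mc mabc; apply: val_inj; rewrite /= !chaosE// chaos_coef_lin.
Qed.

(** A basic neighbourhood of 0 contains a ball of every H_k, so convergence in one of these norms,
    freely chosen, is enough. *)
Lemma kond_cvg (T : Type) (F : set_system T) {FF : Filter F} (f : T -> kondratiev R)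
    (x : kondratiev R) k :
  (forall e : R, 0 < e -> \forall t \near F, (kond_sqnorm k (f t - x)%R < e%:E)%E) ->
  f @ F --> x.
Proof.
move=> H A [U [_ /(_ k)[e [e0 eU]]] UA].
have := H (e ^+ 2) (exprn_gt0 _ e0); apply: filterS => t /eU /UA.
by rewrite addrC subrK.
Qed.

Lemma cvg_chaos_partial_sum b : moderate b ->
  (fun m => chaos (fun n => if (n < m)%N then b n else 0)) @ \oo --> chaos b.
Proof.
move=> [C C0 bC]; apply: (@kond_cvg _ _ _ _ _ 3) => e e0.
have trunc m : moderate (fun n => if (n < m)%N then b n else 0).
  exists C => // n; case: ifPn => // _.
  by rewrite expr0n mulr_ge0// sqrtr_ge0.
pose t m n := if (n < m)%N then 0 else - b n.
have tE m : (fun n => (if (n < m)%N then b n else 0) - b n) = t m.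
  by apply/funext => n; rewrite /t; case: ifP; rewrite ?subrr ?sub0r.
have tC m n : t m n ^+ 2 <= C * Num.sqrt n.+1%:R.
  rewrite /t; case: ifP => _; last by rewrite sqrrN.
  by rewrite expr0n mulr_ge0// sqrtr_ge0.
have E m : kond_coef (chaos (fun n => if (n < m)%N then b n else 0) - chaos b) =
    chaos_coef (t m).
  rewrite -tE -[kond_coef _]/(kond_coef (chaos _) - kond_coef (chaos b)).
  rewrite !chaosE//; last by exists C.
  rewrite (_ : (fun n => _ - _) = (fun n => -1 * b n + if (n < m)%N then b n else 0)).
    by rewrite chaos_coef_lin scaleN1r addrC.
  by apply/funext => n; rewrite mulN1r addrC.
near=> m; rewrite E.
apply: (@le_lt_trans _ _ (C / m.+1%:R)%:E).
  by apply: kond_sqnorm3_chaos_tail_le => // n nm; rewrite /t nm.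
rewrite lte_fin ltr_pdivrMr// mulrC -ltr_pdivrMr//.
near: m; exists (truncn (C / e)).+1 => // m /= hm.
by apply: (lt_le_trans (truncnS_gt _)); rewrite ler_nat; exact: leqW.
Unshelve. all: by end_near. Qed.

Lemma moderate_delta n : moderate (fun m => (m == n)%:R).
Proof.
exists 1 => // m; rewrite mul1r (@le_trans _ _ 1)//; last first.
  by rewrite -[leLHS]sqrtr1 ler_wsqrtr// ler1n.
by case: eqP; rewrite ?expr1n ?expr0n.
Qed.

Lemma sum_chaos_delta b m : \sum_(n < m) b n *: chaos (fun j => (j == n)%:R) =
  chaos (fun n => if (n < m)%N then b n else 0).
Proof.
have trunc k : moderate (fun n => if (n < k)%N then b n else 0).
  exists (\sum_(n < k) b n ^+ 2) => [|n]; first by apply: sumr_ge0 => n _; exact: sqr_ge0.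
  have s1 : 1 <= Num.sqrt n.+1%:R :> R by rewrite -[leLHS]sqrtr1 ler_wsqrtr// ler1n.
  have S0 : 0 <= \sum_(n < k) b n ^+ 2 by apply: sumr_ge0 => ? _; exact: sqr_ge0.
  case: ifPn => [nk|_]; last by rewrite expr0n mulr_ge0// (le_trans _ s1).
  apply: le_trans (ler_peMr S0 s1); rewrite (bigD1 (Ordinal nk))//= lerDl.
  by apply: sumr_ge0 => ? _; exact: sqr_ge0.
elim: m => [|m IHm].
  rewrite big_ord0; apply: val_inj; rewrite /= (chaosE (trunc 0%N)).
  apply/funext => alpha; rewrite /chaos_coef big1// => n _; exact: mul0r.
have E : (fun n => if (n < m.+1)%N then b n else 0) =
    fun n => b m * (n == m)%:R + if (n < m)%N then b n else 0.
  apply/funext => n; rewrite ltnS; have [nm|mn|->] := ltngtP n m.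
  - by rewrite mulr0 add0r.
  - by rewrite mulr0 add0r.
  - by rewrite mulr1 addr0.
rewrite big_ord_recr/= IHm addrC E chaos_lin//; first exact: moderate_delta.
by rewrite -E; exact: trunc.
Qed.

Let zeta_moderate (x : R) : moderate (fun n => hermite_fun n x).
Proof.
exists (hermite_bound `|x|); first exact: hermite_bound_ge0.
by move=> n; exact: hermite_fun_sqr_le.
Qed.

Definition primitive_bound (x : R) : R := (`|x| ^+ 3 + 2) ^+ 2 * hermite_bound `|x|.

Lemma primitive_bound_ge0 x : 0 <= primitive_bound x.
Proof. by rewrite mulr_ge0 ?sqr_ge0 ?hermite_bound_ge0. Qed.

Lemma oint_moderate (x : R) : moderate (fun n => oint (hermite_fun n) 0 x).
Proof.
exists (primitive_bound x); first exact: primitive_bound_ge0.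
move=> n; apply: (le_trans (oint_hermite_le n x)); rewrite ler_wpM2l ?primitive_bound_ge0//.
have s1 : 1 <= Num.sqrt n.+1%:R :> R by rewrite -[leLHS]sqrtr1 ler_wsqrtr// ler1n.
have s3 : 1 <= Num.sqrt n.+1%:R ^+ 3 :> R by rewrite exprn_ege1.
by apply: le_trans s1; rewrite invf_le1// (lt_le_trans _ s3).
Qed.

Definition chaos_zeta (x : R) := chaos (fun n => hermite_fun n x).
Definition chaos_primitive (x : R) := chaos (fun n => oint (hermite_fun n) 0 x).

Lemma cvg_chaos_zeta (x : R) :
  (fun m => \sum_(n < m) hermite_fun n x *: chaos (fun j => (j == n)%:R)) @ \oo
  --> chaos_zeta x.
Proof.
under eq_fun do rewrite (sum_chaos_delta (fun n => hermite_fun n x)).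
exact: cvg_chaos_partial_sum.
Qed.

Lemma kond_coef_comb (a : R) (x y z : kondratiev R) cx cy cz :
  kond_coef x = cx -> kond_coef y = cy -> kond_coef z = cz ->
  kond_coef (a *: (x - y) - z) = a *: (cx - cy) - cz.
Proof. by move=> <- <- <-. Qed.

Lemma chaos_derivative (x : R) (e : R) : 0 < e -> exists2 del : R, 0 < del &
  forall t : R, t != 0 -> `|t| < del ->
  (kond_sqnorm 2 (t^-1 *: (chaos_primitive (x + t) - chaos_primitive x) - chaos_zeta x)%R
    < e%:E)%E.
Proof.
move=> e0; set M := hermite_bound (`|x| + 1).
have M0 : 0 <= M by exact: hermite_bound_ge0.
(* |t| < 1 keeps x + t in the ball of radius |x| + 1 where M is valid, and gives t^2 M <= |t| M;
   dividing by M + 1 covers M = 0. *)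
exists (Num.min 1 (e / (M + 1))).
  by rewrite lt_min ltr01 divr_gt0// ltr_wpDl.
move=> t t0; rewrite lt_min => /andP[t1 te].
pose b n := t^-1 * (oint (hermite_fun n) 0 (x + t) - oint (hermite_fun n) 0 x)
    - hermite_fun n x.
have bC n : b n ^+ 2 <= (t ^+ 2 * M) * Num.sqrt n.+1%:R.
  by rewrite -mulrA; apply: oint_hermite_increment_le => //; rewrite lerD2l ltW.
have -> : kond_coef (t^-1 *: (chaos_primitive (x + t) - chaos_primitive x) - chaos_zeta x) =
    chaos_coef b.
  have Ex y : kond_coef (chaos_primitive y) = chaos_coef (fun n => oint (hermite_fun n) 0 y).
    exact: chaosE (oint_moderate y).
  have Ez : kond_coef (chaos_zeta x) = chaos_coef (fun n => hermite_fun n x).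
    exact: chaosE (zeta_moderate x).
  rewrite (kond_coef_comb t^-1 (Ex (x + t)) (Ex x) Ez).
  apply/funext => alpha.
  rewrite -[LHS]/(t^-1 * (chaos_coef (fun n => oint (hermite_fun n) 0 (x + t)) alpha -
    chaos_coef (fun n => oint (hermite_fun n) 0 x) alpha) -
    chaos_coef (fun n => hermite_fun n x) alpha).
  rewrite /chaos_coef -!sumrB mulr_sumr -sumrB; apply: eq_bigr => n _.
  by rewrite /b; ring.
apply: le_lt_trans (kond_sqnorm2_chaos_le _ bC) _; first by rewrite mulr_ge0// sqr_ge0.
rewrite lte_fin; move: te; rewrite ltr_pdivlMr ?ltr_wpDl// => te.
apply: le_lt_trans te; rewrite -real_normK ?num_real// expr2 -mulrA.
rewrite ler_wpM2l// (@le_trans _ _ (1 * M)) ?ler_wpM2r ?(ltW t1)//; lra.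
Qed.

End FirstChaos.

(** * Identification of L^2 sums of the basis variables with distributions *)

Section FirstChaosExpansion.
Context (R : realType) (sigma : {measure set (measurableTypeR R) -> \bar R}).
Context (P : probability (white_space R) R) (H : hilbert_completion sigma).
Context (Q : H -> white_space R -> R).
Hypotheses (P_sigma : white_noise_measure sigma P) (Q_ext : isometric_extension P Q).
Context (g : nat -> H).
Hypothesis g_orth : forall i j, hc_dot H (g i) (g j) = (i == j)%:R.
Local Notation "''E' f" := (\int[P]_w f w) (at level 10, f at level 8).
Let Z n := Q (g n).

Lemma hc_norm_sum (c : nat -> R) (s : seq nat) : uniq s ->
  `|\sum_(n <- s) c n *: g n| ^+ 2 = \sum_(n <- s) c n ^+ 2.
Proof.
elim: s => [_|n s IHs /= /andP[ns us]]; first by rewrite !big_nil normr0 expr0n.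
rewrite !big_cons hc_norm_orth ?IHs//.
  by rewrite normrZ (hc_norm_basis g_orth) mulr1 real_normK ?num_real.
rewrite linearZl_LR/= linear_sumr/= big_seq big1 ?mulr0// => i si.
rewrite linearZr_LR/= g_orth; case: eqP => [ni|_]; last by rewrite mulr0.
by move: ns; rewrite ni si.
Qed.

(** By Pythagoras, blocks of the vector series have as squared norms the blocks of the series of
    c_n^2, so the Cauchy criterion transfers, with e^2 for e. *)
Lemma hilbert_sum_cvg (c : nat -> R) (K : R) : (forall m, \sum_(n < m) c n ^+ 2 <= K) ->
  exists v : H, (fun m => \sum_(n < m) c n *: g n) @ \oo --> v.
Proof.
move=> cK.
have cs : cvgn (series (fun n => c n ^+ 2)).
  apply: nondecreasing_is_cvgn.
    by apply: nondecreasing_series => n _ _; exact: sqr_ge0.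
  by exists K => _ [m _ <-]; rewrite /series/= big_mkord.
have : cvgn (series (fun n => c n *: g n)).
  apply/cauchy_cvgP/cauchy_seriesP => e e0.
  move/cauchy_cvgP/cauchy_seriesP : cs => /(_ (e ^+ 2)); rewrite exprn_gt0// => /(_ isT).
  apply: filterS => -[m n] /=.
  rewrite -hc_norm_sum ?iota_uniq// normrX normr_id.
  by rewrite ltr_pXn2r// nnegrE// ltW.
move=> /cvg_ex[v sv]; exists v.
by move: sv; rewrite /series/=; under eq_fun do rewrite big_mkord.
Qed.

Lemma sum_basis_Lfun2 (c : nat -> R) m : \sum_(n < m) c n *: Z n \in Lfun P 2%:E.
Proof.
apply: all_moments_Lfun2.
elim: m => [|m IHm]; first by rewrite big_ord0; exact: (all_moments_cst P 0).
rewrite big_ord_recr/=; apply: all_momentsD => //.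
apply: all_momentsM; first exact: (all_moments_cst P (c m)).
exact: (basis_all_moments P_sigma Q_ext g_orth).
Qed.

Lemma sum_basisE (c : nat -> R) m w :
  (\sum_(n < m) c n *: Z n) w = \sum_(n < m) c n * Z n w.
Proof. by elim/big_rec2: _ => // n x f _ <-. Qed.

Lemma cvg_norm_sub (u : nat -> H) v : u @ \oo --> v -> (fun m => `|u m - v|) @ \oo --> (0 : R).
Proof.
move=> /subr_cvg0 uv; have := cvg_norm uv.
by rewrite normr0; apply.
Qed.

Lemma L2_limit_sum (c : nat -> R) v : (fun m => \sum_(n < m) c n *: g n) @ \oo --> v ->
  L2_limit P (fun m => \sum_(n < m) c n *: Z n) (Q v).
Proof.
move=> cv; split=> [m||]; [exact: sum_basis_Lfun2|exact: (Q_Lfun2 Q_ext)|].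
have E m : ('N[P]_2%:E[EFin \o ((\sum_(n < m) c n *: Z n)%R \- Q v)%R])%E =
    (`|\sum_(n < m) c n *: g n - v|)%:E.
  rewrite -(Q_norm Q_ext); apply: ae_eq_Lnorm2.
  - apply: measurable_funB; last exact: (Q_measurable Q_ext).
    exact: Lfun_measurable (sum_basis_Lfun2 c m).
  - exact: (Q_measurable Q_ext).
  - apply: filterS2 (Q_sub Q_ext (\sum_(n < m) c n *: g n) v) (Q_sum Q_ext c g m) => w h1 h2 _.
    by rewrite h1// h2// -sum_basisE.
rewrite (_ : (fun m => _) = fun m => (`|\sum_(n < m) c n *: g n - v|)%:E); last exact/funext.
apply: cvg_EFin; first exact: nearW.
exact: cvg_norm_sub.
Qed.

(** The coefficients of the partial sums have two limits: the one given by continuity, and their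
    eventually constant value, reached at [eps j] as soon as m > j. *)
Lemma integral_sum_wick (c : nat -> R) v alpha :
  (fun m => \sum_(n < m) c n *: g n) @ \oo --> v ->
  'E (fun w => Q v w * wick_basis Z alpha w) = chaos_coef c alpha.
Proof.
move=> cv; have hY := wick_basis_Lfun2 P_sigma Q_ext g_orth alpha.
set C := fine 'N[P]_2%:E[EFin \o wick_basis Z alpha]%E.
pose L u := 'E (fun w => Q u w * wick_basis Z alpha w).
have lim1 : (fun m => L (\sum_(n < m) c n *: g n)) @ \oo --> L v.
  apply/subr_cvg0; apply: norm_cvg0.
  have B : (fun m => `|\sum_(n < m) c n *: g n - v| * C) @ \oo --> (0 : R).
    have := cvgM (cvg_norm_sub cv) (cvg_cst C : (fun _ : nat => C) @ \oo --> C).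
    by rewrite mul0r; apply.
  apply: (@squeeze_cvgr _ _ _ _ (cst 0) _ _ _ _ _ B) => //; last exact: cvg_cst.
  by apply: nearW => m; rewrite normr_ge0 (dist_integral_le Q_ext).
have lim2 : (fun m => L (\sum_(n < m) c n *: g n)) @ \oo --> chaos_coef c alpha.
  have [[j aE]|aj] := pselect (exists j, alpha = eps j).
    rewrite aE chaos_coef_eps; apply: cvg_near_cst; exists j.+1 => // m /= jm.
    rewrite /L (integral_partial_sum_wick P_sigma Q_ext g_orth).
    rewrite aE (bigD1 (Ordinal jm))//= eqxx mulr1 big1 ?addr0// => i ij.
    case: eqP => [/eps_inj ji|_]; last by rewrite mulr0.
    by move: ij; rewrite -val_eqE/= ji eqxx.
  rewrite chaos_coef_out; last by move=> n; apply/eqP => an; apply: aj; exists n.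
  apply: cvg_near_cst; apply: nearW => m.
  rewrite /L (integral_partial_sum_wick P_sigma Q_ext g_orth) big1// => i _.
  by case: eqP => [an|_]; [case: aj; exists i|rewrite mulr0].
exact: (cvg_unique _ lim1 lim2).
Qed.

Lemma L2_distribution_sum (c : nat -> R) v : moderate c ->
  (fun m => \sum_(n < m) c n *: g n) @ \oo --> v ->
  L2_distribution P Z (Q v) (chaos c).
Proof.
move=> mc cv; split=> [|alpha]; first exact: (Q_Lfun2 Q_ext).
rewrite (integral_sum_wick _ cv) chaosE//.
have [[j ->]|aj] := pselect (exists j, alpha = eps j).
  by rewrite multi_fact_eps divr1.
by rewrite chaos_coef_out ?mul0r// => n; apply/eqP => an; apply: aj; exists n.
Qed.

Lemma L2_distribution_basis n : L2_distribution P Z (Z n) (chaos (fun j => (j == n)%:R)).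
Proof.
apply: L2_distribution_sum; first exact: moderate_delta.
apply: cvg_near_cst; exists n.+1 => // m /= nm.
rewrite (bigD1 (Ordinal nm))//= eqxx scale1r big1 ?addr0// => i.
by rewrite -val_eqE/= => /negbTE ->; rewrite scale0r.
Qed.

Lemma brownian_expansion (x : R) : exists X : white_space R -> R,
  L2_limit P (fun m => \sum_(n < m) oint (hermite_fun n) 0 x *: Z n) X /\
  L2_distribution P Z X (chaos_primitive x).
Proof.
have [m|v cv] := @hilbert_sum_cvg (fun n => oint (hermite_fun n) 0 x) (primitive_bound x * 3).
  apply: (@le_trans _ _ (\sum_(n < m) primitive_bound x / Num.sqrt n.+1%:R ^+ 3)).
    by apply: ler_sum => n _; exact: oint_hermite_le.
  by rewrite -mulr_sumr ler_wpM2l ?primitive_bound_ge0 ?sum_inv_sqrt_cube_le.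
exists (Q v); split; first exact: (@L2_limit_sum (fun n => oint (hermite_fun n) 0 x)).
exact: L2_distribution_sum (oint_moderate x) _.
Qed.

End FirstChaosExpansion.

(** * Limits in the hyperbolic variable *)

Section HyperbolicLimits.
Variable R : realType.

Lemma lam1D (p q : hyp R) : lam1 (p + q) = lam1 p + lam1 q.
Proof. by rewrite /lam1 /=; ring. Qed.

Lemma lam2D (p q : hyp R) : lam2 (p + q) = lam2 p + lam2 q.
Proof. by rewrite /lam2 /=; ring. Qed.

Lemma lam1V (q : hyp R) : q \is a GRing.unit -> lam1 q != 0 /\ lam1 q^-1 = (lam1 q)^-1.
Proof.
move=> uq; have q0 : lam1 q * lam2 q != 0 := uq.
move: (q0); rewrite mulf_eq0 negb_or => /andP[a b]; split=> //.
have -> : q^-1 = hinv q by [].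
rewrite /hinv uq /lam1 /=; move: a b; rewrite /lam1 /lam2 => a b.
by field; apply/andP.
Qed.

Lemma lam2V (q : hyp R) : q \is a GRing.unit -> lam2 q != 0 /\ lam2 q^-1 = (lam2 q)^-1.
Proof.
move=> uq; have q0 : lam1 q * lam2 q != 0 := uq.
move: (q0); rewrite mulf_eq0 negb_or => /andP[a b]; split=> //.
have -> : q^-1 = hinv q by [].
rewrite /hinv uq /lam2 /=; move: a b; rewrite /lam1 /lam2 => a b.
by field; apply/andP.
Qed.

Lemma norm_lam_le (q : hyp R) : `|lam1 q| <= 2 * hnorm q /\ `|lam2 q| <= 2 * hnorm q.
Proof.
have ha : `|hre q| <= hnorm q.
  by rewrite -sqrtr_sqr ler_wsqrtr// lerDl sqr_ge0.
have hb : `|him q| <= hnorm q.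
  by rewrite -sqrtr_sqr ler_wsqrtr// lerDr sqr_ge0.
rewrite mulr_natl mulr2n; split.
  by rewrite (le_trans (ler_normD _ _))// lerD.
by rewrite (le_trans (ler_normB _ _))// lerD.
Qed.

Global Instance hyp_units_to0_filter : Filter (hyp_units_to0 R).
Proof.
apply: within_filter; apply: filter_from_filter; first by exists 1; rewrite /= ltr01.
move=> i j i0 j0; exists (Num.min i j); first by rewrite /= lt_min; apply/andP.
by move=> q /=; rewrite lt_min => /andP.
Qed.

(** Reduces the hyperbolic limit to two real ones: both components become small, and invertibility
    makes both nonzero. *)
Lemma near_hyp_units (d : R) : 0 < d -> \forall q \near hyp_units_to0 R,
  [/\ q \is a GRing.unit, `|lam1 q| < d & `|lam2 q| < d].
Proof.
move=> d0; exists (d / 2); first by rewrite /= divr_gt0.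
move=> q /= qd uq; have [h1 h2] := norm_lam_le q.
have qd2 : 2 * hnorm q < d by rewrite mulrC -ltr_pdivlMr.
by split=> //; [exact: le_lt_trans h1 _|exact: le_lt_trans h2 _].
Qed.

Lemma hkond_sum (x y : nat -> kondratiev R) m :
  (\sum_(n < m) ((x n, y n) : hkondratiev R)) = (\sum_(n < m) x n, \sum_(n < m) y n).
Proof.
elim: m => [|m IHm]; first by rewrite !big_ord0.
by rewrite !big_ord_recr/= IHm.
Qed.

Lemma hkond_cvg (T : Type) (F : set_system T) {FF : Filter F}
    (f g : T -> kondratiev R) (x y : kondratiev R) :
  f @ F --> x -> g @ F --> y ->
  (fun t => (f t, g t) : hkondratiev R) @ F --> ((x, y) : hkondratiev R).
Proof. by move=> fx gy; exact: (cvg_pair fx gy). Qed.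

End HyperbolicLimits.

Unset Implicit Arguments.

Theorem theorem8p1 (R : realType)
    (sigma mu : {measure set (measurableTypeR R) -> \bar R})
    (sigma_growth : (\int[sigma]_u ((u ^+ 2 + 1)^-1)%:E < +oo)%E)
    (mu_growth : (\int[mu]_u ((u ^+ 2 + 1)^-1)%:E < +oo)%E)
    (H1 : hilbert_completion sigma) (H2 : hilbert_completion mu)
    (g : nat -> H1) (h : nat -> H2)
    (g_basis : orthonormal_basis g) (h_basis : orthonormal_basis h)
    (P1 P2 : probability (white_space R) R)
    (P1_sigma : white_noise_measure sigma P1)
    (P2_mu : white_noise_measure mu P2)
    (Q1 : H1 -> white_space R -> R) (Q2 : H2 -> white_space R -> R)
    (Q1_ext : isometric_extension P1 Q1) (Q2_ext : isometric_extension P2 Q2) :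
  let Z n : white_space R -> R := Q1 (g n) in
  let W n : white_space R -> R := Q2 (h n) in
  exists (z w : nat -> kondratiev R) (B N : hyp R -> hkondratiev R),
  [/\ forall n, L2_distribution P1 Z (Z n) (z n) /\
                L2_distribution P2 W (W n) (w n),
      forall p, exists X Y : white_space R -> R,
        [/\ L2_limit P1
              (fun m => \sum_(n < m) oint (hermite_fun n) 0 (lam1 p) *: Z n) X,
            L2_limit P2
              (fun m => \sum_(n < m) oint (hermite_fun n) 0 (lam2 p) *: W n) Y,
            L2_distribution P1 Z X (B p).1
          & L2_distribution P2 W Y (B p).2],
      forall p,
        \sum_(n < m) ((hermite_fun n (lam1 p) *: z n,
                       hermite_fun n (lam2 p) *: w n) : hkondratiev R)
          @[m --> \oo] --> N p
    & forall p, q^-1 *: (B (p + q) - B p) @[q --> hyp_units_to0 R] --> N p].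
Proof.
move=> Z W; have [g_orth _] := g_basis; have [h_orth _] := h_basis.
(* One family serves both components: elements are coefficient families, and the coefficients of Z_n
   and W_n are the same, 1 at [eps n]. *)
pose z n : kondratiev R := chaos (fun j => (j == n)%:R).
exists z, z, (fun p => (chaos_primitive (lam1 p), chaos_primitive (lam2 p))),
  (fun p => (chaos_zeta (lam1 p), chaos_zeta (lam2 p))).
split=> [n|p|p|p].
- by split; [exact: (L2_distribution_basis P1_sigma Q1_ext g_orth)|
    exact: (L2_distribution_basis P2_mu Q2_ext h_orth)].
- have [X [X1 X2]] := brownian_expansion P1_sigma Q1_ext g_orth (lam1 p).
  have [Y [Y1 Y2]] := brownian_expansion P2_mu Q2_ext h_orth (lam2 p).
  by exists X, Y; split; [exact: X1|exact: Y1|exact: X2|exact: Y2].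
- under eq_fun do rewrite (hkond_sum (fun n => hermite_fun n (lam1 p) *: z n)
    (fun n => hermite_fun n (lam2 p) *: z n)).
  by apply: hkond_cvg; exact: cvg_chaos_zeta.
(* Scaling by q^-1 acts through [lam1 q^-1] and [lam2 q^-1], so the quotient is by definition a pair
   of real difference quotients. *)
- apply: (@hkond_cvg _ _ _ _
    (fun q => lam1 q^-1 *: (chaos_primitive (lam1 (p + q)) - chaos_primitive (lam1 p)))
    (fun q => lam2 q^-1 *: (chaos_primitive (lam2 (p + q)) - chaos_primitive (lam2 p)))).
    apply: (@kond_cvg _ _ _ _ _ _ 2) => e e0.
    have [d d0 hd] := chaos_derivative (lam1 p) e0.
    apply: filterS (near_hyp_units d0) => q [uq q1 _].
    by have [q0 ->] := lam1V uq; rewrite lam1D; exact: hd.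
  apply: (@kond_cvg _ _ _ _ _ _ 2) => e e0.
  have [d d0 hd] := chaos_derivative (lam2 p) e0.
  apply: filterS (near_hyp_units d0) => q [uq _ q2].
  by have [q0 ->] := lam2V uq; rewrite lam2D; exact: hd.
Qed.
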